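(* Let $\langle X,X'\rangle$ be a conditional dual pair, where $X$ is a conditional locally convex topological vector space whose conditional topology is compatible with $\langle X,X'\rangle$. If $U$ is a conditional neighborhood of $0$ in $X$, then the conditional polar $U^\bullet=\{x'\in X':|\langle x,x'\rangle|\leqslant1\text{ for all }x\in U\}$ is conditionally $\sigma(X',X)$-compact.
   Context: $\mathcal{A}$ is a complete Boolean algebra with $0\ne1$; $p(a)$ is the set of families $(a_i)$ with $\bigvee a_i=a$, $a_i\wedge a_j=0$ ($i\ne j$). Conditional sets $X=(X_a,\gamma_a)_{a\in\mathcal A}$ are families of sets with surjections $\gamma_a:X_1\to X_a$ ($X_0$ a singleton, $\gamma_1=\mathrm{id}$), consistent and stable (unique gluing $\sum a_ix_i$ over $(a_i)\in p(1)$); conditional subsets living on $b$ are non-empty subsets of $X_b$ closed under gluing, forming under $\sqsubseteq$ a complete Boolean algebra (operations $\sqcup,\sqcap$, least element $\mathbf0$). Conditional functions are families $f_a:X_a\to Y_a$ with $f_a(ax)=af_1(x)$. A conditional topology is a collection of conditional subsets containing $\mathbf0$ and $X$, closed under gluing, finite $\sqcap$ and arbitrary $\sqcup$; conditional continuity means preimages of open sets are open; a conditional neighborhood of $x\in X_1$ is a conditional subset $U$ living on $1$ with $x\sqsubseteq O\sqsubseteq U$ for some open $O$. $\mathbf{R}$ is the conditional real numbers with the conditional Euclidean topology (base of balls $\{y:|x-y|<\varepsilon\}$, $\varepsilon>0$). A conditional $\mathbf R$-vector space is a conditional set with conditional operations $+$, $\cdot:\mathbf{R}\times X\to X$ making $X_1$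 an $\mathbf R_1$-module; conditional linearity of $f$ means $f(\lambda x+y)=\lambda f(x)+f(y)$. A conditional topological vector space has a conditional topology making $+$ and $\cdot$ conditionally continuous; it is locally convex if $0$ has a conditional neighborhood base of conditionally convex sets ($C$ is conditionally convex if $\lambda x+(1-\lambda)y\in C$ for $x,y\in C$, $0\leqslant\lambda\leqslant1$). A conditional dual pair $\langle X,X'\rangle$ consists of conditional vector spaces $X,X'$ and a conditional function $\langle\cdot,\cdot\rangle:X\times X'\to\mathbf{R}$ conditionally linear in each argument, such that $\langle\cdot,x'\rangle=0$ implies $x'=0$ and $\langle x,\cdot\rangle=0$ implies $x=0$. $\sigma(X',X)$ is the conditional initial topology on $X'$ for the conditional family of functions $x'\mapsto\langle x,x'\rangle$, $x\in X$, i.e. the smallest conditional topology making them all conditionally continuous (and similarly $\sigma(X,X')$). The conditional topology $\mathcal T$ of $X$ is compatible with $\langle X,X'\rangle$ if the conditional vector space of conditionally continuous linear functions $X\to\mathbf{R}$ equals $X'$ (via $x'\mapsto\langle\cdot,x'\rangle$). A conditional subset $Y$ is conditionally compact if it is conditionally compact in the relative conditional topology: every conditional family of relatively open sets $(O^j)_{j\in J}$ covering $Y$ admits $(a_i)\in p(1)$ and finite $J^i\subseteq J_1$ with $a_iY\sqsubseteq\sqcup_{j\in J^i}(O^j\sqcap a_iY)$ for each $i$. *)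

(* Defs.v *)
From HB Require Import structures.
From mathcomp Require Import all_boot all_order.
From mathcomp Require Import boolp classical_sets cardinality.

Set Implicit Arguments.
Unset Strict Implicit.
Unset Printing Implicit Defensive.

Import Order.Theory.
Local Open Scope classical_set_scope.
Local Open Scope order_scope.

(* A Boolean algebra is a [ctbDistrLatticeType]; [supremums] is the set of
   least upper bounds. *)
Definition complete d (A : ctbDistrLatticeType d) : Prop :=
  forall S : set A, supremums S !=set0.

(* The family c is an element of p(a). *)
Definition partition_of d (A : ctbDistrLatticeType d) (a : A) (I : Type)
    (c : I -> A) : Prop :=
  supremums (range c) a /\ forall i j, i <> j -> c i `&` c j = \bot.

(* X a is the set X_a and cproj X a : X_1 -> X_a is the surjection gamma_a. *)
Record condSet d (A : ctbDistrLatticeType d) := CondSet {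
  clevel :> A -> Type;
  cproj : forall a, clevel \top -> clevel a;
  cproj_surj : forall a (y : clevel a), exists x, cproj a x = y;
  cproj_top : forall x, cproj \top x = x;
  clevel_bot : exists x0 : clevel \bot, forall x, x = x0;
  cproj_consistent : forall a b x y, a <= b ->
    cproj b x = cproj b y -> cproj a x = cproj a y;
  cproj_stable : forall (I : Type) (c : I -> A) (x : I -> clevel \top),
    partition_of \top c ->
    exists! z, forall i, cproj (c i) z = cproj (c i) (x i) }.

Arguments cproj {d A c0} a x.

(* The restriction X_b -> X_a of an element; meaningful only for a <= b, in
   which case it does not depend on the chosen preimage (see [cresE]). *)
Definition cres d (A : ctbDistrLatticeType d) (X : condSet A) (a : A) (b : A)
    (x : X b) : X a :=
  cproj a (projT1 (cid (cproj_surj x))).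
Arguments cres {d A X} a {b} x : simpl never.

Lemma cresE d (A : ctbDistrLatticeType d) (X : condSet A) (a b : A)
    (x : X \top) : a <= b -> cres a (cproj b x) = cproj a x.
Proof.
move=> ab; rewrite /cres; case: cid => y /= yx.
exact: cproj_consistent ab yx.
Qed.

Lemma cres_top d (A : ctbDistrLatticeType d) (X : condSet A) (a : A)
    (x : X \top) : cres a x = cproj a x.
Proof. by rewrite -[in LHS](cproj_top x) cresE ?lex1. Qed.

(* S is a subset of X_b closed under gluing along partitions of b. *)
Definition cstable d (A : ctbDistrLatticeType d) (X : condSet A) (b : A)
    (S : set (X b)) : Prop :=
  forall (I : Type) (c : I -> A) (y : I -> X b) (z : X b),
    partition_of b c -> (forall i, S (y i)) ->
    (forall i, cres (c i) z = cres (c i) (y i)) -> S z.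

(* Conditional subset of X living on csub_on. *)
Record csub d (A : ctbDistrLatticeType d) (X : condSet A) := Csub {
  csub_on : A;
  csub_elt : set (X csub_on);
  csub_neq0 : csub_elt !=set0;
  csub_stable : cstable csub_elt }.

Arguments csub_elt {d A X} c _.

(* x in X_a is the restriction to a of an element of U. *)
Definition cmem d (A : ctbDistrLatticeType d) (X : condSet A) (a : A)
    (x : X a) (U : csub X) : Prop :=
  a <= csub_on U /\ exists2 u, csub_elt U u & cres a u = x.

Definition csubset d (A : ctbDistrLatticeType d) (X : condSet A)
    (U V : csub X) : Prop :=
  csub_on U <= csub_on V /\ forall x, csub_elt U x -> cmem x V.

Section Partitions.
Context d (A : ctbDistrLatticeType d).

Lemma partition_of_le (a : A) I (c : I -> A) i :
  partition_of a c -> c i <= a.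
Proof. by case=> -[ub _] _; apply: ub; exists i. Qed.

Definition two (a : A) (i : bool) : A := if i then a else ~` a.

Lemma partition_two (a : A) : partition_of \top (two a).
Proof.
split; first split.
- by move=> _ [i _ <-]; exact: lex1.
- move=> u ub; rewrite -(joinxC a) leUx.
  by rewrite (ub a) ?(ub (~` a)) //; [exists false|exists true].
- by case=> -[] //= _; rewrite ?meetxC ?meetCx.
Qed.

Lemma partition_option (b e : A) I (c : I -> A) : e <= b ->
  partition_of e c ->
  partition_of b (fun o => if o is Some i then c i else b `&` ~` e).
Proof.
move=> eb pc; have ce i := partition_of_le i pc.
case: (pc) => -[_ lub] disj; split; first split.
- move=> _ [[i|] _ <-]; first exact: le_trans (ce i) eb.
  exact: leIl.
- move=> u ub.
  have eu : e <= u by apply: lub => _ [i _ <-]; apply: ub; exists (Some i).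
  have bu : b `&` ~` e <= u by apply: ub; exists None.
  rewrite -(meetx1 b) -(joinxC e) meetUr leUx bu andbT.
  exact: le_trans (leIr _ _) eu.
- have ne i : c i `&` (b `&` ~` e) = \bot.
    apply/eqP; rewrite -lex0 -(meetxC e); apply: leI2; first exact: ce.
    exact: leIr.
  move=> [i|] [j|] //= ij; last by rewrite meetC.
  by apply: disj => ji; apply: ij; rewrite ji.
Qed.

Lemma partition_bot (a : A) I (c : I -> A) : partition_of \top c ->
  (forall i, a `&` c i = \bot) -> a = \bot.
Proof.
move=> [[_ lub] _] ac; have : \top <= ~` a.
  apply: lub => _ [i _ <-].
  rewrite -(meetx1 (c i)) -(joinxC a) meetUr meetC ac join0x.
  exact: leIr.
by move=> aT; apply/eqP; rewrite -lex0 -(meetxC a) lexI lexx (le_trans (lex1 a)).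
Qed.

Lemma partition_meet (a : A) I (c : I -> A) : partition_of \top c ->
  partition_of a (fun i => a `&` c i).
Proof.
move=> [[_ lub] disj]; split; first split.
- by move=> _ [i _ <-]; exact: leIl.
- move=> u ub; have : \top <= ~` a `|` u.
    apply: lub => _ [i _ <-]; rewrite -(meet1x (c i)) -(joinxC a) meetUl leUx.
    rewrite (le_trans (ub _ _) (leUr _ _)) ?andTb; last by exists i.
    exact: le_trans (leIl _ _) (leUl _ _).
  move=> aT; rewrite -(meetx1 a); apply: le_trans (leI2 (lexx a) aT) _.
  by rewrite meetUr meetxC join0x leIr.
- by move=> i j ij; rewrite meetACA meetxx disj // meetx0.
Qed.

Lemma cglue2 (X : condSet A) (a : A) (x y : X \top) :
  exists z : X \top, cproj a z = cproj a x /\ cproj (~` a) z = cproj (~` a) y.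
Proof.
have [z [zE _]] :=
  cproj_stable (fun i : bool => if i then x else y) (partition_two a).
by exists z; split; [exact: (zE true)|exact: (zE false)].
Qed.

Lemma cproj_ext2 (X : condSet A) (a : A) (x y : X \top) :
  cproj a x = cproj a y -> cproj (~` a) x = cproj (~` a) y -> x = y.
Proof.
move=> e1 e2.
have [z [_ zU]] := cproj_stable (fun _ : bool => y) (partition_two a).
by rewrite -(zU x) ?(zU y) // => -[].
Qed.

Lemma cproj_ext (X : condSet A) (a : A) I (c : I -> A) (x y : X \top) :
  partition_of \top c ->
  (forall i, cproj (a `&` c i) x = cproj (a `&` c i) y) ->
  cproj a x = cproj a y.
Proof.
move=> pc xy; have [z [z1 z2]] := cglue2 a x y.
have pT := partition_option (lex1 a) (partition_meet a pc).
have [t [_ tU]] := cproj_stable (fun=> y) pT.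
suff zy : z = y by rewrite -z1 zy.
rewrite -(tU z) ?(tU y) // => -[i|]; last by rewrite meet1x.
by rewrite -xy; apply: cproj_consistent z1; exact: leIl.
Qed.

End Partitions.

Section Restriction.
Context d (A : ctbDistrLatticeType d) (X : condSet A).

Lemma cfull_neq0 (b : A) : [set: X b] !=set0.
Proof.
have [x0 _] := clevel_bot X; have [x _] := cproj_surj x0.
by exists (cproj b x).
Qed.

Lemma cfull_stable (b : A) : cstable [set: X b].
Proof. by []. Qed.

(* The set X_b as a conditional subset living on b. X itself is cfull \top,
   and the least element of the algebra of conditional subsets is cfull \bot,
   which is not empty: it is the singleton X_0. *)
Definition cfull (b : A) : csub X := Csub (cfull_neq0 b) (@cfull_stable b).

Lemma crestr_neq0 (a : A) (U : csub X) :
  [set cres (a `&` csub_on U) u | u in csub_elt U] !=set0.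
Proof. by case: (csub_neq0 U) => u Uu; exists (cres (a `&` csub_on U) u), u. Qed.

Lemma crestr_stable (a : A) (U : csub X) :
  cstable [set cres (a `&` csub_on U) u | u in csub_elt U].
Proof.
move=> I c y z pc yU zy;
set b := csub_on U in y z pc yU zy *.
set e := a `&` b in y z pc yU zy *.
have eb : e <= b by exact: leIr.
have [u0 Uu0] := csub_neq0 U.
have [w0 w0E] := cproj_surj u0; have [w wE] := cproj_surj z.
have [v [v1 v2]] := cglue2 e w w0.
exists (cproj b v); last by rewrite cresE // v1.
have /choice[u uP] : forall i, exists u, csub_elt U u /\ cres e u = y i.
  by move=> i; have [u Uu ue] := yU i; exists u.
apply: (@csub_stable _ _ _ U _
  (fun o => if o is Some i then c i else b `&` ~` e)
  (fun o => if o is Some i then u i else u0)).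
- exact: partition_option.
- by case=> [i|] //; case: (uP i).
- case=> [i|] /=.
    have ce := partition_of_le i pc; have [_ uE] := uP i.
    rewrite cresE ?(le_trans ce) //.
    rewrite (cproj_consistent ce v1).
    rewrite -(cresE w ce) wE zy -uE.
    have [t <-] := cproj_surj (u i).
    by rewrite !cresE // (le_trans ce).
  rewrite cresE ?leIl // -w0E cresE ?leIl //.
  by apply: cproj_consistent v2; exact: leIr.
Qed.

(* The conditional subset aU, living on a /\ b if U lives on b. *)
Definition crestr (a : A) (U : csub X) : csub X :=
  Csub (crestr_neq0 a U) (@crestr_stable a U).

(* Joins and meets are those of the order csubset. *)
Definition is_cjoin (F : set (csub X)) (G : csub X) : Prop :=
  (forall U, F U -> csubset U G) /\
  forall H, (forall U, F U -> csubset U H) -> csubset G H.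

Definition is_cmeet (U V W : csub X) : Prop :=
  [/\ csubset W U, csubset W V &
      forall H, csubset H U -> csubset H V -> csubset H W].

Definition is_ctop (T : set (csub X)) : Prop :=
  [/\ T (cfull \bot),
      T (cfull \top),
      forall (I : Type) (c : I -> A) (O : I -> csub X) (G : csub X),
        partition_of \top c -> (forall i, T (O i)) ->
        (forall i, crestr (c i) G = crestr (c i) (O i)) -> T G,
      forall U V W, T U -> T V -> is_cmeet U V W -> T W &
      forall (F : set (csub X)) G, F `<=` T -> is_cjoin F G -> T G].

Definition is_nbhs (T : set (csub X)) (x : X \top) (U : csub X) : Prop :=
  csub_on U = \top /\ exists2 O, T O & cmem x O /\ csubset O U.

(* The opens of the topology with base B are the joins of pieces aV, V in B. *)
Definition ctop_of_base (B : set (csub X)) : set (csub X) :=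
  [set O | exists2 F : set (csub X),
     (forall U, F U -> exists a V, B V /\ U = crestr a V) & is_cjoin F O].

Definition relatively_open (T : set (csub X)) (Y : csub X) : set (csub X) :=
  [set W | exists2 O, T O & is_cmeet O Y W].

(* O is the component at 1 of a conditional function on J with values in the
   conditional subsets of X; its other components are determined by it. *)
Definition is_cfamily (J : condSet A) (O : J \top -> csub X) : Prop :=
  forall a j k, cproj a j = cproj a k -> crestr a (O j) = crestr a (O k).

Definition ccompact (T : set (csub X)) (Y : csub X) : Prop :=
  forall (J : condSet A) (O : J \top -> csub X),
    is_cfamily O -> (forall j, relatively_open T Y (O j)) ->
    (exists2 G, is_cjoin (range O) G & csubset Y G) ->
    exists (I : Type) (c : I -> A) (D : I -> set (J \top)),
      partition_of \top c /\
      forall i, finite_set (D i) /\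
        exists2 G,
          is_cjoin
            [set W | exists2 j, D i j & is_cmeet (O j) (crestr (c i) Y) W] G
          & csubset (crestr (c i) Y) G.

End Restriction.

Record cfun d (A : ctbDistrLatticeType d) (X Y : condSet A) := Cfun {
  cfun_at :> forall a, X a -> Y a;
  cfunE : forall a x, cfun_at (cproj a x) = cproj a (cfun_at x) }.

(* P is the conditional preimage of O under f: it is the only conditional
   subset with these elements at every level. *)
Definition is_cpreimage d (A : ctbDistrLatticeType d) (X Y : condSet A)
    (f : cfun X Y) (O : csub Y) (P : csub X) : Prop :=
  forall a (x : X a), cmem x P <-> cmem (f a x) O.

Definition ccontinuous d (A : ctbDistrLatticeType d) (X Y : condSet A)
    (TX : set (csub X)) (TY : set (csub Y)) (f : cfun X Y) : Prop :=
  forall O, TY O -> exists2 P, is_cpreimage f O P & TX P.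

Definition cinitial d (A : ctbDistrLatticeType d) (X Y : condSet A)
    (TY : set (csub Y)) (F : set (cfun X Y)) : set (csub X) :=
  \bigcap_(T in [set T | is_ctop T /\ forall f, F f -> ccontinuous T TY f]) T.

Section Product.
Context d (A : ctbDistrLatticeType d) (X Y : condSet A).

Let lev (a : A) : Type := (X a * Y a)%type.
Let pr a (x : lev \top) : lev a := (cproj a x.1, cproj a x.2).

Let pr_surj a (y : lev a) : exists x, pr a x = y.
Proof.
case: y => y1 y2.
have [x1 <-] := cproj_surj y1; have [x2 <-] := cproj_surj y2.
by exists (x1, x2).
Qed.

Let pr_top x : pr \top x = x.
Proof. by case: x => x1 x2; rewrite /pr /= !cproj_top. Qed.

Let lev_bot : exists x0 : lev \bot, forall x, x = x0.
Proof.
have [x0 x0P] := clevel_bot X; have [y0 y0P] := clevel_bot Y.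
by exists (x0, y0) => -[x y]; rewrite (x0P x) (y0P y).
Qed.

Let pr_consistent a b x y : a <= b -> pr b x = pr b y -> pr a x = pr a y.
Proof.
by move=> ab [e1 e2]; rewrite /pr (cproj_consistent ab e1) (cproj_consistent ab e2).
Qed.

Let pr_stable (I : Type) (c : I -> A) (x : I -> lev \top) :
  partition_of \top c -> exists! z, forall i, pr (c i) z = pr (c i) (x i).
Proof.
move=> pc.
have [z1 [z1E z1U]] := cproj_stable (fun i => (x i).1) pc.
have [z2 [z2E z2U]] := cproj_stable (fun i => (x i).2) pc.
exists (z1, z2); split=> [i|[t1 t2] tE]; first by rewrite /pr /= z1E z2E.
by rewrite (z1U t1) ?(z2U t2) // => i; have [] := tE i.
Qed.

Definition cprod : condSet A :=
  CondSet pr_surj pr_top lev_bot pr_consistent pr_stable.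

Definition cfst : cfun cprod X :=
  @Cfun d A cprod X (fun a x => x.1) (fun a x => erefl).
Definition csnd : cfun cprod Y :=
  @Cfun d A cprod Y (fun a x => x.2) (fun a x => erefl).

Definition cprod_top (TX : set (csub X)) (TY : set (csub Y)) :
    set (csub cprod) :=
  \bigcap_(T in [set T | [/\ is_ctop T, ccontinuous T TX cfst &
                            ccontinuous T TY csnd]]) T.

End Product.

(* The value at level a of a conditional binary operation. *)
Definition cop d (A : ctbDistrLatticeType d) (X Y Z : condSet A)
    (f : cfun (cprod X Y) Z) a (x : X a) (y : Y a) : Z a := f a (x, y).

Lemma copE d (A : ctbDistrLatticeType d) (X Y Z : condSet A)
    (f : cfun (cprod X Y) Z) a (x : X \top) (y : Y \top) :
  cop f (cproj a x) (cproj a y) = cproj a (cop f x y).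
Proof. exact: (cfunE f a (x, y)). Qed.

(* The conditional real numbers, up to isomorphism: a conditionally totally
   ordered, conditionally Dedekind complete conditional field. The axioms are
   stated on R_1; by gluing they hold at every level. *)
Record condReal d (A : ctbDistrLatticeType d) := CondReal {
  rset :> condSet A;
  radd_fun : cfun (cprod rset rset) rset;
  rmul_fun : cfun (cprod rset rset) rset;
  ropp_fun : cfun rset rset;
  rzero : rset \top;
  rone : rset \top;
  rle_sub : csub (cprod rset rset);
  radd : rset \top -> rset \top -> rset \top := cop radd_fun (a := \top);
  rmul : rset \top -> rset \top -> rset \top := cop rmul_fun (a := \top);
  ropp : rset \top -> rset \top := ropp_fun \top;
  (* the order at level a *)
  rle_at : forall a : A, rset a -> rset a -> Prop :=
    fun a x y => cmem ((x, y) : cprod rset rset a) rle_sub;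
  rle : rset \top -> rset \top -> Prop := @rle_at \top;
  raddA : forall x y z, radd x (radd y z) = radd (radd x y) z;
  raddC : forall x y, radd x y = radd y x;
  radd0 : forall x, radd x rzero = x;
  raddN : forall x, radd x (ropp x) = rzero;
  rmulA : forall x y z, rmul x (rmul y z) = rmul (rmul x y) z;
  rmulC : forall x y, rmul x y = rmul y x;
  rmul1 : forall x, rmul x rone = x;
  rmulDr : forall x y z, rmul x (radd y z) = radd (rmul x y) (rmul x z);
  rone_neq0 : forall a, cproj a rone = cproj a rzero -> a = \bot;
  rinv_ex : forall x, (forall a, cproj a x = cproj a rzero -> a = \bot) ->
    exists y, rmul x y = rone;
  rle_on : csub_on rle_sub = \top;
  rle_refl : forall x, rle x x;
  rle_anti : forall x y, rle x y -> rle y x -> x = y;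
  rle_trans : forall x y z, rle x y -> rle y z -> rle x z;
  rle_total : forall x y, exists a,
    rle_at (cproj a x) (cproj a y) /\ rle_at (cproj (~` a) y) (cproj (~` a) x);
  rle_add : forall x y z, rle x y -> rle (radd x z) (radd y z);
  rle_mul : forall x y, rle rzero x -> rle rzero y -> rle rzero (rmul x y);
  rle_dedekind : forall S : csub rset, csub_on S = \top ->
    (exists m, forall x : rset \top, cmem x S -> rle x m) ->
    exists s, (forall x : rset \top, cmem x S -> rle x s) /\
      forall m, (forall x : rset \top, cmem x S -> rle x m) -> rle s m }.

Arguments rzero {d A R} : rename.
Arguments rone {d A R} : rename.
Arguments radd {d A R} : rename.
Arguments rmul {d A R} : rename.
Arguments ropp {d A R} : rename.
Arguments rle_at {d A R a} : rename.
Arguments rle {d A R} : rename.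

Section RealTheory.
Context d (A : ctbDistrLatticeType d) (R : condReal A).
Implicit Types (x y z m : R \top) (a b : A).

Definition rsub x y : R \top := radd x (ropp y).

(* 0 < x means that x > 0 holds everywhere: x >= 0 and ax = a0 only for a = 0 *)
Definition rlt x y : Prop :=
  rle x y /\ forall a, cproj a x = cproj a y -> a = \bot.

Lemma rle_glue (I : Type) (c : I -> A) (x y : I -> R \top) z t :
  partition_of \top c -> (forall i, rle (x i) (y i)) ->
  (forall i, cproj (c i) z = cproj (c i) (x i)) ->
  (forall i, cproj (c i) t = cproj (c i) (y i)) -> rle z t.
Proof.
move=> pc xy zx ty; split; first by rewrite (rle_on R).
have onT := rle_on R; rewrite /rle /rle_at /cmem in xy.
move: (rle_sub R) onT xy => [b S S0 Sst] /= bT; subst b => xy.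
exists (z, t); last by rewrite cres_top cproj_top.
apply: (Sst I c (fun i => (x i, y i))) => // i.
  by case: (xy i) => _ [u Su]; rewrite cres_top cproj_top => <-.
by rewrite !cres_top /= zx ty.
Qed.

Lemma rle_at_glue a x y : rle_at (cproj a x) (cproj a y) <->
  exists u v, [/\ rle u v, cproj a u = cproj a x & cproj a v = cproj a y].
Proof.
have onT := rle_on R; rewrite /rle /rle_at /cmem.
move: (rle_sub R) onT => [b S S0 Sst] /= bT; subst b; split.
  case=> _ [[u v] Suv]; rewrite cres_top => -[ux vy].
  exists u, v; split=> //; split; first exact: lex1.
  by exists (u, v) => //; rewrite cres_top cproj_top.
case=> u [v [[_ [w Sw wE]] ux vy]]; split; first exact: lex1.
rewrite cres_top cproj_top in wE; exists w => //.
by rewrite cres_top wE /= ux vy.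
Qed.

Lemma rle_cproj a x y : rle x y -> rle_at (cproj a x) (cproj a y).
Proof. by move=> xy; apply/rle_at_glue; exists x, y. Qed.

Lemma rle_at_le a b x y : a <= b ->
  rle_at (cproj b x) (cproj b y) -> rle_at (cproj a x) (cproj a y).
Proof.
move=> ab /rle_at_glue[u [v [uv ux vy]]]; apply/rle_at_glue; exists u, v.
by split=> //; apply: cproj_consistent ab _.
Qed.

Lemma rle_two a x y : rle_at (cproj a x) (cproj a y) ->
  rle_at (cproj (~` a) x) (cproj (~` a) y) -> rle x y.
Proof.
move=> /rle_at_glue[u [v [uv ux vy]]] /rle_at_glue[u' [v' [uv' ux' vy']]].
apply: (rle_glue (x := fun i : bool => if i then u else u')
  (y := fun i : bool => if i then v else v') (partition_two a)); by case.
Qed.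

Lemma rle_at_anti a x y : rle_at (cproj a x) (cproj a y) ->
  rle_at (cproj a y) (cproj a x) -> cproj a x = cproj a y.
Proof.
move=> xy yx.
have [z [z1 z2]] := cglue2 a x y.
suff zy : z = y by rewrite -z1 zy.
by apply: rle_anti; apply: (@rle_two a); rewrite ?z1 ?z2 //;
  apply/rle_cproj/rle_refl.
Qed.

Lemma rle_at_refl a x : rle_at (cproj a x) (cproj a x).
Proof. exact/rle_cproj/rle_refl. Qed.

Lemma ropp_cproj a x y : cproj a x = cproj a y ->
  cproj a (ropp x) = cproj a (ropp y).
Proof. by move=> xy; rewrite /ropp -!cfunE xy. Qed.

Lemma radd_cproj a x y x' y' : cproj a x = cproj a x' ->
  cproj a y = cproj a y' -> cproj a (radd x y) = cproj a (radd x' y').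
Proof. by move=> xx yy; rewrite /radd -!copE xx yy. Qed.

Lemma rmul_cproj a x y x' y' : cproj a x = cproj a x' ->
  cproj a y = cproj a y' -> cproj a (rmul x y) = cproj a (rmul x' y').
Proof. by move=> xx yy; rewrite /rmul -!copE xx yy. Qed.

Lemma radd_idem x : radd x x = x -> x = rzero.
Proof. by move=> xx; rewrite -[LHS]radd0 -[X in radd x X](raddN x) raddA xx raddN. Qed.

Lemma ropp0 : ropp rzero = rzero :> R \top.
Proof. by rewrite -[RHS](raddN (rzero : R \top)) raddC radd0. Qed.

Lemma rmul0 x : rmul x rzero = rzero.
Proof. by apply: radd_idem; rewrite -rmulDr radd0. Qed.

Lemma rmulNN x : rmul (ropp x) (ropp x) = rmul x x.
Proof.
have e1 : radd (rmul (ropp x) (ropp x)) (rmul (ropp x) x) = rzero.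
  by rewrite -rmulDr raddC raddN rmul0.
have e2 : radd (rmul x x) (rmul x (ropp x)) = rzero.
  by rewrite -rmulDr raddN rmul0.
rewrite -[LHS]radd0 -e2 (rmulC x (ropp x)) (raddC (rmul x x)) raddA e1.
by rewrite raddC radd0.
Qed.

Lemma rle01 : rle (rzero : R \top) rone.
Proof.
have [a [le1 le2]] := rle_total (rzero : R \top) rone.
have [e [e1 e2]] := cglue2 a (rzero : R \top) rone.
have e0 : rle e rzero.
  by apply: (@rle_two a); rewrite ?e1 ?e2 //; exact: rle_at_refl.
have Ne0 : rle rzero (ropp e).
  by have := rle_add (ropp e) e0; rewrite raddN raddC radd0.
have ee : rmul e e = e.
  apply: (@cproj_ext2 _ _ _ a).
    by rewrite (rmul_cproj e1 e1) rmul0 e1.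
  by rewrite (rmul_cproj e2 e2) rmul1 e2.
have e0' : e = rzero.
  by apply: rle_anti => //; rewrite -ee -rmulNN; exact: rle_mul.
have a1 : ~` a = \bot by apply: (@rone_neq0 _ _ R); rewrite -e2 e0'.
apply: (@rle_two a) => //; rewrite a1.
apply/rle_at_glue; exists rzero, rzero; split=> //; first exact: rle_refl.
have [w wP] := clevel_bot R.
by rewrite (wP (cproj \bot rzero)) (wP (cproj \bot rone)).
Qed.

(* m is x where x >= 0 and -x where x <= 0 *)
Definition is_abs x m : Prop := exists a,
  [/\ rle_at (cproj a rzero) (cproj a x), cproj a m = cproj a x,
      rle_at (cproj (~` a) x) (cproj (~` a) rzero) &
      cproj (~` a) m = cproj (~` a) (ropp x)].

Lemma is_abs_ex x : exists m, is_abs x m.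
Proof.
have [a [le1 le2]] := rle_total (rzero : R \top) x.
have [m [m1 m2]] := cglue2 a x (ropp x).
by exists m, a.
Qed.

Definition rabs x : R \top := projT1 (cid (is_abs_ex x)).

Lemma rabsP x : is_abs x (rabs x).
Proof. by rewrite /rabs; case: cid. Qed.

Lemma is_abs_cproj c x y m n : is_abs x m -> is_abs y n ->
  cproj c x = cproj c y -> cproj c m = cproj c n.
Proof.
have zeroN b z w k : rle_at (cproj b rzero) (cproj b z) ->
    rle_at (cproj b w) (cproj b rzero) -> cproj b z = cproj b w ->
    cproj b k = cproj b (ropp z) -> cproj b z = cproj b k.
  move=> z0 w0 zw ->; have z0E : cproj b z = cproj b rzero.
    by apply: rle_at_anti => //; rewrite zw.
  by rewrite (ropp_cproj z0E) ropp0.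
have down b1 b2 (X : condSet A) (z w : X \top) : b1 <= b2 ->
  cproj b2 z = cproj b2 w -> cproj b1 z = cproj b1 w.
  exact: cproj_consistent.
move=> [a [x0 mx x0' mx']] [b [y0 ny y0' ny']] xy.
apply: (cproj_ext (partition_two a)) => -[] /=;
  apply: (cproj_ext (partition_two b)) => -[] /=; set e := _ `&` _;
  have ec : e <= c by rewrite /e -meetA leIl.
all: have xye := down _ _ _ _ _ ec xy.
- have ea : e <= a by rewrite /e meetAC leIr.
  have eb : e <= b by rewrite /e leIr.
  by rewrite (down _ _ _ _ _ ea mx) (down _ _ _ _ _ eb ny).
- have ea : e <= a by rewrite /e meetAC leIr.
  have eb : e <= ~` b by rewrite /e leIr.
  rewrite (down _ _ _ _ _ ea mx); apply: (zeroN _ _ y).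
  + exact: rle_at_le ea x0.
  + exact: rle_at_le eb y0'.
  + by [].
  + by rewrite (down _ _ _ _ _ eb ny'); apply: ropp_cproj.
- have ea : e <= ~` a by rewrite /e meetAC leIr.
  have eb : e <= b by rewrite /e leIr.
  rewrite (down _ _ _ _ _ eb ny); apply/esym; apply: (zeroN _ _ x).
  + exact: rle_at_le eb y0.
  + exact: rle_at_le ea x0'.
  + by [].
  + by rewrite (down _ _ _ _ _ ea mx'); apply: ropp_cproj.
- have ea : e <= ~` a by rewrite /e meetAC leIr.
  have eb : e <= ~` b by rewrite /e leIr.
  rewrite (down _ _ _ _ _ ea mx') (down _ _ _ _ _ eb ny').
  exact: ropp_cproj.
Qed.

Lemma rabs_cproj c x y : cproj c x = cproj c y ->
  cproj c (rabs x) = cproj c (rabs y).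
Proof. by move=> xy; apply: is_abs_cproj xy; exact: rabsP. Qed.

Lemma rabs0 : rabs rzero = rzero.
Proof.
rewrite -[LHS]cproj_top -[RHS]cproj_top.
apply: is_abs_cproj (rabsP _) _ erefl; exists \top.
by split=> //; [exact: rle_at_refl|exact: rle_at_refl|rewrite ropp0].
Qed.

Section Ball.
Context (x e : R \top) (e0 : rlt rzero e).

Lemma ball_neq0 : [set y | rlt (rabs (rsub x y)) e] !=set0.
Proof. by exists x => /=; rewrite /rsub raddN rabs0. Qed.

Lemma ball_stable : cstable [set y | rlt (rabs (rsub x y)) e].
Proof.
move=> I c y z pc yS zy.
have zE i : cproj (c i) (rabs (rsub x z)) = cproj (c i) (rabs (rsub x (y i))).
  apply: rabs_cproj; apply: radd_cproj => //; apply: ropp_cproj.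
  by move: (zy i); rewrite !cres_top.
split.
  apply: (rle_glue (y := fun=> e) pc) => [i|i|//]; last exact: zE.
  by case: (yS i).
move=> a ae; apply: (partition_bot pc) => i.
case: (yS i) => _; apply.
rewrite -(cproj_consistent _ (zE i)) ?leIr //.
by apply: cproj_consistent ae; exact: leIl.
Qed.

(* The ball of radius e > 0 around x. *)
Definition ball : csub R := Csub ball_neq0 ball_stable.

End Ball.

Definition euclidean_top : set (csub R) :=
  ctop_of_base [set U | exists x e (e0 : rlt rzero e), U = ball x e0].

End RealTheory.

Arguments euclidean_top {d A} R.

(* vadd and vscale make X_1 a module over the ring R_1. *)
Record condVect d (A : ctbDistrLatticeType d) (R : condReal A) := CondVect {
  vset :> condSet A;
  vadd_fun : cfun (cprod vset vset) vset;
  vscale_fun : cfun (cprod R vset) vset;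
  vzero : vset \top;
  vadd : vset \top -> vset \top -> vset \top := cop vadd_fun (a := \top);
  vscale : R \top -> vset \top -> vset \top := cop vscale_fun (a := \top);
  vaddA : forall x y z, vadd x (vadd y z) = vadd (vadd x y) z;
  vaddC : forall x y, vadd x y = vadd y x;
  vadd0 : forall x, vadd x vzero = x;
  vaddN : forall x, exists y, vadd x y = vzero;
  vscaleA : forall k l x, vscale k (vscale l x) = vscale (rmul k l) x;
  vscale1 : forall x, vscale rone x = x;
  vscaleDr : forall k x y, vscale k (vadd x y) = vadd (vscale k x) (vscale k y);
  vscaleDl : forall k l x, vscale (radd k l) x = vadd (vscale k x) (vscale l x) }.

Arguments vzero {d A R X} : rename.
Arguments vadd {d A R X} : rename.
Arguments vscale {d A R X} : rename.

Record condTVS d (A : ctbDistrLatticeType d) (R : condReal A) := CondTVS {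
  tvs_vect :> condVect R;
  tvs_top : set (csub tvs_vect);
  tvs_is_top : is_ctop tvs_top;
  tvs_add_cont :
    ccontinuous (cprod_top tvs_top tvs_top) tvs_top (vadd_fun tvs_vect);
  tvs_scale_cont :
    ccontinuous (cprod_top (euclidean_top R) tvs_top) tvs_top
      (vscale_fun tvs_vect) }.

Arguments tvs_top {d A R} X : rename.

Section DualPair.
Context d (A : ctbDistrLatticeType d) (R : condReal A).

Definition cconvex (X : condVect R) (C : csub X) : Prop :=
  forall (x y : X \top) (l : R \top), cmem x C -> cmem y C ->
    rle rzero l -> rle l rone ->
    cmem (vadd (vscale l x) (vscale (rsub rone l) y)) C.

Definition locally_convex (X : condTVS R) : Prop :=
  forall U : csub X, is_nbhs (tvs_top X) vzero U ->
    exists C, [/\ is_nbhs (tvs_top X) vzero C, cconvex C & csubset C U].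

Definition clinear (X : condVect R) (f : cfun X R) : Prop :=
  forall (l : R \top) (x y : X \top),
    f \top (vadd (vscale l x) y) = radd (rmul l (f \top x)) (f \top y).

(* The partial functions of a conditional function of two arguments. *)
Section Partial.
Context (X Y : condSet A) (p : cfun (cprod X Y) R).

Lemma cpartl_subproof (y : Y \top) a (x : X \top) :
  cop p (cproj a x) (cproj a y) = cproj a (cop p x (cproj \top y)).
Proof. by rewrite cproj_top copE. Qed.

Lemma cpartr_subproof (x : X \top) a (y : Y \top) :
  cop p (cproj a x) (cproj a y) = cproj a (cop p (cproj \top x) y).
Proof. by rewrite cproj_top copE. Qed.

Definition cpartl (y : Y \top) : cfun X R :=
  @Cfun d A X R (fun a x => cop p x (cproj a y)) (cpartl_subproof y).

Definition cpartr (x : X \top) : cfun Y R :=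
  @Cfun d A Y R (fun a y => cop p (cproj a x) y) (cpartr_subproof x).

End Partial.

Record dualPair (X X' : condVect R) := DualPair {
  dp_fun : cfun (cprod X X') R;
  pairing : X \top -> X' \top -> R \top := cop dp_fun (a := \top);
  dp_linl : forall x' : X' \top, clinear (cpartl dp_fun x');
  dp_linr : forall x : X \top, clinear (cpartr dp_fun x);
  dp_sepr : forall x' : X' \top,
    (forall x : X \top, pairing x x' = rzero) -> x' = vzero;
  dp_sepl : forall x : X \top,
    (forall x' : X' \top, pairing x x' = rzero) -> x = vzero }.

(* sigma(X', X): cpartr _ x is the function x' |-> <x, x'> *)
Definition weak_top (X X' : condVect R) (p : dualPair X X') : set (csub X') :=
  cinitial (euclidean_top R) (range (cpartr (dp_fun p))).

Definition compatible (X : condTVS R) (X' : condVect R) (p : dualPair X X') :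
    Prop :=
  [set f | clinear f /\ ccontinuous (tvs_top X) (euclidean_top R) f]
  = range (cpartl (dp_fun p)).

Section Polar.
Context (X X' : condVect R) (p : dualPair X X') (U : csub X).

Let polar_set : set (X' \top) :=
  [set x' | forall x : X \top, cmem x U -> rle (rabs (pairing p x x')) rone].

Lemma pairing0 (x : X \top) : pairing p x vzero = rzero.
Proof.
have := dp_linr p x rone vzero vzero; rewrite /= vscale1 vadd0 cproj_top.
by rewrite rmulC rmul1 => /esym /radd_idem.
Qed.

Lemma polar_neq0 : polar_set !=set0.
Proof. by exists vzero => x _; rewrite pairing0 rabs0; exact: rle01. Qed.

Lemma polar_stable : cstable polar_set.
Proof.
move=> I c y z pc yP zy x Ux.
apply: (rle_glue (x := fun i => rabs (pairing p x (y i))) (y := fun=> rone) pc)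
  => // i; first exact: yP.
apply: rabs_cproj; rewrite /pairing -!copE.
by move: (zy i); rewrite !cres_top => ->.
Qed.

Definition cpolar : csub X' := Csub polar_neq0 polar_stable.

End Polar.

End DualPair.

Arguments compatible {d A R} X {X'} p.

(* Main.v *)
(* Every relation is replaced by its truth value in A: [tmem x U] is the largest
   a on which x belongs to U, and a conditional subset is the same thing as an
   extensional function X_1 -> A. In these terms the classical proof of the
   Banach-Alaoglu theorem goes through.

   Let g be the supremum of the truth values with which finite unions of members
   of the cover fill the polar; compactness amounts to g = 1. A minimal sublinear map
   is an A-valued ultrafilter h on the polar, giving each member of the cover a
   value at most g. A neighborhood of 0 is absorbing, so x' |-> <x, x'> is bounded
   on the polar and, by Dedekind completeness, has a limit phi x along h. The map
   phi is linear and bounded by 1 on U, hence continuous, so phi = <., x0> by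
   compatibility, with x0 in the polar. The conditional subsets W with
   [tmem x0 W <= h (tmem . W)] form a conditional topology that makes every
   evaluation continuous; so it contains the weak topology, and h converges to
   x0. Since x0 is covered, 1 <= g. *)
Require Import Defs.
From HB Require Import structures.
From mathcomp Require Import all_boot all_order ssralg.
From mathcomp Require Import boolp classical_sets cardinality.
From mathcomp Require Import ring.

Set Implicit Arguments.
Unset Strict Implicit.
Unset Printing Implicit Defensive.

Import Order.Theory.
Local Open Scope classical_set_scope.
Local Open Scope order_scope.

(** * Complete Boolean algebras *)

Section CompleteBooleanAlgebra.
Context d (A : ctbDistrLatticeType d) (Ac : complete A).
Implicit Types (a b c : A) (S : set A).

(** Residuation: the right-hand side uses the Boolean implication. It carries hypotheses across
    suprema, as in [meet_bexists_le]. *)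
Lemma leI_impl a b c : (a `&` b <= c) = (a <= ~` b `|` c).
Proof. by rewrite -leBLR diffE complK. Qed.

(** Case analysis inside [A], used with an element and its complement or with the totality of an
    order. *)
Lemma le_split a b p q : p `|` q = \top -> a `&` p <= b -> a `&` q <= b ->
  a <= b.
Proof. by move=> pq ap aq; rewrite -(meetx1 a) -pq meetUr leUx ap. Qed.

Lemma meet_le_bot a b c : a <= b -> a <= ~` b -> a <= c.
Proof.
move=> ab anb; apply: le_trans (le0x c).
by rewrite -(meetxC b) lexI ab.
Qed.

Lemma le_compl_bot a b : a `&` b <= \bot -> a <= ~` b.
Proof. by rewrite lex0 disj_leC. Qed.

(** Completeness only asserts that a least upper bound exists, so one is chosen; the default \bot is
    never taken when [A] is complete. *)
Definition bsup S : A := xget \bot (supremums S).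

Lemma bsupP S : supremums S (bsup S).
Proof. exact: xgetPex (Ac S). Qed.

Lemma le_bsup S a : S a -> a <= bsup S.
Proof. by case: (bsupP S) => ub _; exact: ub. Qed.

Lemma bsup_le S b : (forall a, S a -> a <= b) -> bsup S <= b.
Proof. by case: (bsupP S) => _ lub Sb; apply: lub. Qed.

Definition bexists (T : Type) (P : T -> A) : A := bsup (range P).

(** An infimum written through suprema, since completeness is stated for suprema. *)
Definition bforall (T : Type) (P : T -> A) : A := ~` bexists (fun t => ~` P t).

Lemma le_bexists T (P : T -> A) t : P t <= bexists P.
Proof. by apply: le_bsup; exists t. Qed.

Lemma bexists_le T (P : T -> A) b : (forall t, P t <= b) -> bexists P <= b.
Proof. by move=> Pb; apply: bsup_le => _ [t _ <-]. Qed.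

Lemma meet_bexists_le T (P : T -> A) a b :
  (forall t, a `&` P t <= b) -> a `&` bexists P <= b.
Proof.
move=> aPb; rewrite meetC leI_impl; apply: bexists_le => t.
by rewrite -leI_impl meetC.
Qed.

Lemma bexistsS T (P Q : T -> A) : (forall t, P t <= Q t) ->
  bexists P <= bexists Q.
Proof. by move=> PQ; apply: bexists_le => t; exact: le_trans (le_bexists _ t). Qed.

Lemma bforall_le T (P : T -> A) t : bforall P <= P t.
Proof. by rewrite /bforall leCx (le_bexists (fun t => ~` P t)). Qed.

Lemma le_bforall T (P : T -> A) a : (forall t, a <= P t) -> a <= bforall P.
Proof. by move=> aP; rewrite /bforall lexC; apply: bexists_le => t; rewrite leC. Qed.

(* A maximal disjoint family of elements below a, each below some P t, has
   supremum a. *)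
Lemma exhaustion T (P : T -> A) a : a <= bexists P ->
  exists (I : Type) (c : I -> A) (t : I -> T),
    partition_of a c /\ forall i, c i <= P (t i).
Proof.
move=> aP.
pose good (D : set A) := (forall x, D x -> x <= a /\ exists t, x <= P t) /\
  forall x y, D x -> D y -> x <> y -> x `&` y = \bot.
have [F Fgood Ftot|D [[Da Ddisj] Dmax]] := @Zorn_bigcup A good.
  split=> [x [D FD Dx]|x y [D FD Dx] [E FE Ey] xy].
    by have [+ _] := Fgood _ FD; apply.
  have [DE|ED] := Ftot _ _ FD FE.
    by have [_ +] := Fgood _ FE; apply=> //; exact: DE.
  by have [_ +] := Fgood _ FD; apply=> //; exact: ED.
have /choice[t tP] : forall i : {x | D x}, exists t, projT1 i <= P t.
  by case=> x Dx; have [] := Da x Dx.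
exists {x | D x}, (@projT1 _ _), t; split=> //; split; first split.
- by move=> _ [[x Dx] _ <-] /=; have [] := Da x Dx.
- move=> u Du; set e := a `&` ~` u.
  suff e0 : e = \bot by rewrite -[u]complK -disj_leC -/e e0.
  apply/eqP; rewrite -lex0.
  have : e <= bexists P by exact: le_trans (leIl _ _) aP.
  rewrite leEmeet => /eqP <-; apply: meet_bexists_le => s.
  set x := e `&` P s; have xu : x <= ~` u.
    by rewrite /x /e; rewrite -meetA meetCA leIl.
  have Dx0 y : D y -> y `&` x = \bot.
    move=> Dy; apply/eqP; rewrite disj_leC.
    apply: (le_trans (y := u)); last by rewrite lexC.
    by apply: Du; exists (exist _ y Dy).
  (* [x] is disjoint from every member of [D]. If it belongs to [D] it is disjoint from itself,
     hence \bot; otherwise adding it to [D] contradicts maximality. *)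
  have [/Dx0|nDx] := pselect (D x); first by rewrite meetxx => ->.
  exfalso; apply: (Dmax (D `|` [set x])).
    by split=> [y Dy|DxD]; [left|apply: nDx; apply: DxD; right].
  split=> [y [/Da//|->]|y z].
    by split; [rewrite /x /e -meetA leIl|exists s; exact: leIr].
  move=> [Dy|->] [Dz|->] yz //.
  + exact: Ddisj.
  + exact: Dx0.
  + by rewrite meetC Dx0.
- move=> [x Dx] [y Dy] /= xy; apply: Ddisj => // e; apply: xy; subst y.
  by congr exist; exact: Prop_irrelevance.
Qed.

(** Exhaustion splits [a] into pieces below elements satisfying [Q]; descent and gluing carry [Q]
    back to [a]. Truth values defined as suprema are therefore attained. *)
Lemma le_bsup_local (Q : A -> Prop) a :
  (forall b c, b <= c -> Q c -> Q b) ->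
  (forall b I (c : I -> A), partition_of b c -> (forall i, Q (c i)) -> Q b) ->
  a <= bsup Q <-> Q a.
Proof.
move=> Qle Qglue; split=> [aQ|]; last exact: le_bsup.
have aE : a <= bexists (fun x : {x | Q x} => projT1 x).
  apply: le_trans aQ _; apply: bsup_le => x Qx.
  exact: (le_bexists (fun x : {x | Q x} => projT1 x) (exist _ x Qx)).
have [I [c [t [pc ct]]]] := exhaustion aE.
apply: Qglue pc _ => i; apply: Qle (ct i) _; exact: projT2.
Qed.

End CompleteBooleanAlgebra.

(** * Truth values *)

Section TruthValues.
Context d (A : ctbDistrLatticeType d) (Ac : complete A) (X : condSet A).
Implicit Types (a b c : A) (x y z : X \top) (U V W : csub X).

Lemma cproj_bot x y : cproj \bot x = cproj \bot y.
Proof.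
by have [w wP] := clevel_bot X; rewrite (wP (cproj _ x)) (wP (cproj _ y)).
Qed.

Lemma cproj_glue b I (c : I -> A) x y : partition_of b c ->
  (forall i, cproj (c i) x = cproj (c i) y) -> cproj b x = cproj b y.
Proof.
move=> pc xy; apply: (cproj_ext (partition_option (lex1 b) pc)) => -[i|].
  exact: cproj_consistent (leIr _ _) (xy i).
by rewrite meet1x meetxC; exact: cproj_bot.
Qed.

Lemma cglue_le b I (c : I -> A) (x : I -> X \top) y : partition_of b c ->
  exists z, (forall i, cproj (c i) z = cproj (c i) (x i)) /\
    cproj (~` b) z = cproj (~` b) y.
Proof.
move=> pc; have [z [zE _]] := cproj_stable
  (fun o => if o is Some i then x i else y) (partition_option (lex1 b) pc).
exists z; split=> [i|]; first exact: (zE (Some i)).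
by have := zE None; rewrite meet1x.
Qed.

Lemma cmem_le a b x U : a <= b -> cmem (cproj b x) U -> cmem (cproj a x) U.
Proof.
move=> ab [bU [u Uu ux]]; split; first exact: le_trans bU.
exists u => //; have [w wu] := cproj_surj u; rewrite -wu cresE // in ux.
by rewrite -wu cresE ?(le_trans ab) //; exact: cproj_consistent ux.
Qed.

Lemma cmem_glue b I (c : I -> A) x U : partition_of b c ->
  (forall i, cmem (cproj (c i) x) U) -> cmem (cproj b x) U.
Proof.
move=> pc xU.
have bU : b <= csub_on U.
  by case: (pc) => -[_ +] _; apply=> _ [i _ <-]; case: (xU i).
split=> //; have /choice[u uP] : forall i,
    exists u, csub_elt U u /\ cres (c i) u = cproj (c i) x.
  by move=> i; have [_ [u Uu ux]] := xU i; exists u.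
have [u0 Uu0] := csub_neq0 U; have [w0 w0E] := cproj_surj u0.
have [v [v1 v2]] := cglue2 b x w0.
exists (cproj (csub_on U) v); last by rewrite cresE.
(* [U] is closed under gluing along partitions of [csub_on U], while [c] only partitions [b]; the
   fixed element [u0] fills the rest. *)
apply: (@csub_stable _ _ _ U _
  (fun o => if o is Some i then c i else csub_on U `&` ~` b)
  (fun o => if o is Some i then u i else u0)).
- exact: partition_option.
- by case=> [i|] //; case: (uP i).
- have ci i : c i <= b by exact: partition_of_le pc.
  case=> [i|]; last first.
    rewrite -w0E !cresE ?leIl //.
    by apply: cproj_consistent v2; exact: leIr.
  rewrite cresE ?(le_trans (ci i)) //; case: (uP i) => _ ->.
  exact: cproj_consistent (ci i) v1.
Qed.

(* The truth values of x = y and of x \in U. *)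
Definition teq x y : A := bsup [set a | cproj a x = cproj a y].

Definition tmem x U : A := bsup [set a | cmem (cproj a x) U].

Lemma le_teq a x y : a <= teq x y <-> cproj a x = cproj a y.
Proof.
apply: (le_bsup_local Ac) => [b c bc|b I c pc]; first exact: cproj_consistent.
exact: cproj_glue.
Qed.

Lemma le_tmem a x U : a <= tmem x U <-> cmem (cproj a x) U.
Proof.
apply: (le_bsup_local Ac) => [b c bc|b I c pc]; first exact: cmem_le.
exact: cmem_glue.
Qed.

Lemma teqP x y : teq x y = \top <-> x = y.
Proof.
split=> [xy|->].
  rewrite -(cproj_top x) -(cproj_top y); apply/le_teq; by rewrite xy.
by apply/eqP; rewrite eq_le lex1; apply/le_teq.
Qed.

Lemma teq_refl x : teq x x = \top. Proof. exact/teqP. Qed.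

Lemma teqC x y : teq x y = teq y x.
Proof.
by apply/eqP; rewrite eq_le; apply/andP; split; apply/le_teq/esym/le_teq.
Qed.

Lemma tmemP x U : tmem x U = \top <-> cmem x U.
Proof.
split=> [xU|xU]; first by rewrite -(cproj_top x); apply/le_tmem; rewrite xU.
by apply/eqP; rewrite eq_le lex1; apply/le_tmem; rewrite cproj_top.
Qed.

Definition extensional (P : X \top -> A) : Prop :=
  forall x y, P x `&` teq x y <= P y.

Lemma tmem_ext U : extensional (tmem^~ U).
Proof.
move=> x y; apply/le_tmem.
have /le_teq <- : tmem x U `&` teq x y <= teq x y by exact: leIr.
by apply/le_tmem; exact: leIl.
Qed.

Lemma le_tmem_teq a x y U : a <= teq x y -> a <= tmem x U -> a <= tmem y U.
Proof. by move=> xy xU; apply: le_trans (tmem_ext U x y); rewrite lexI xU. Qed.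

(** Witnesses of the supremum live on the pieces of a partition and glue to one element;
    extensionality transports [P] to it. *)
Lemma maximum_principle (P : X \top -> A) : extensional P ->
  exists x, P x = bexists P.
Proof.
move=> Pext; have [I [c [t [pc ct]]]] := exhaustion Ac (lexx (bexists P)).
have [x0 _] := clevel_bot X; have [y0 _] := cproj_surj x0.
have [z [zt _]] := cglue_le t y0 pc; exists z.
apply/eqP; rewrite eq_le (le_bexists Ac) /=.
case: pc => -[_ +] _; apply=> _ [i _ <-].
apply: le_trans (Pext (t i) z); rewrite lexI ct.
by apply/le_teq; rewrite zt.
Qed.

Lemma le_csub_on a U : a <= csub_on U <-> exists x, a <= tmem x U.
Proof.
split=> [aU|[x /le_tmem[]//]]; have [u Uu] := csub_neq0 U.
have [x xu] := cproj_surj u; exists x; apply/le_tmem; split=> //.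
by exists u; rewrite // -xu cresE.
Qed.

Lemma csubsetP U V : csubset U V <-> forall x, tmem x U <= tmem x V.
Proof.
split=> [[UV sUV] x|UV].
  apply/le_tmem; have /le_tmem[aU [u /sUV[_ [v Vv vu]] ux]] := lexx (tmem x U).
  split; first exact: le_trans UV.
  exists v => //; rewrite -ux -vu; have [w <-] := cproj_surj v.
  by rewrite !cresE // (le_trans aU).
have UVon : csub_on U <= csub_on V.
  apply/le_csub_on; have /le_csub_on[x xU] := lexx (csub_on U).
  by exists x; exact: le_trans (UV x).
split=> // u Uu; have [x xu] := cproj_surj u; rewrite -xu.
apply/le_tmem; apply: le_trans (UV x); apply/le_tmem; split=> //.
by exists u; rewrite // -xu cresE.
Qed.

Lemma csubset_anti U V : csubset U V -> csubset V U -> U = V.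
Proof.
case: U => a S S0 Sst; case: V => b S' S0' Sst' [/= ab sUV] [/= ba sVU].
have e : a = b by apply/eqP; rewrite eq_le ab.
subst b; have cresaa (x : X a) : cres a x = x.
  by have [w <-] := cproj_surj x; rewrite cresE.
have SS' : S = S'.
  apply/seteqP; split=> x.
    by move=> /sUV[_ [v /= Sv]]; rewrite cresaa => <-.
  by move=> /sVU[_ [v /= Sv]]; rewrite cresaa => <-.
subst S'; congr Csub; exact: Prop_irrelevance.
Qed.

Lemma csub_ext U V : (forall x, tmem x U = tmem x V) -> U = V.
Proof. by move=> UV; apply: csubset_anti; apply/csubsetP => x; rewrite UV. Qed.

(** With [tmem_ext] and [csub_ext], this identifies conditional subsets with extensional functions.
    The set lives on the supremum [b] of [P], which is attained, so it is non-empty even when [b] is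
    \bot. *)
Lemma csub_of (P : X \top -> A) : extensional P ->
  exists U, forall x, tmem x U = P x.
Proof.
move=> Pext; set b := bexists P.
have [m mb] := maximum_principle Pext; have {}mb : P m = b by [].
have Pb x : P x <= b by exact: le_bexists.
have Pcproj a x y : cproj a x = cproj a y -> a <= P x -> a <= P y.
  by move=> /le_teq xy ax; apply: le_trans (Pext x y); rewrite lexI ax.
pose S : set (X b) := [set y | exists2 x, cproj b x = y & b <= P x].
have S0 : S !=set0 by exists (cproj b m), m => //; rewrite mb.
have Sst : cstable S.
  move=> I c y z pc yS zy; have [w wz] := cproj_surj z.
  exists w => //; case: (pc) => -[_ +] _; apply=> _ [i _ <-].
  have ci := partition_of_le i pc.
  have [x xy bx] := yS i; apply: (Pcproj _ x); last exact: le_trans bx.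
  by move: (zy i); rewrite -xy -wz !cresE.
exists (Csub S0 Sst) => x; apply/eqP; rewrite eq_le; apply/andP; split.
  have /le_tmem[/= aU [_ [u <- bu]]] := lexx (tmem x (Csub S0 Sst)).
  rewrite cresE // => ux; apply: Pcproj ux _; exact: le_trans bu.
apply/le_tmem; split; first exact: Pb.
(* [x] satisfies [P] only on [P x]; the maximizer [m] supplies the rest, so that [u] belongs to the
   set over all of [b]. *)
have [u [u1 u2]] := cglue2 (P x) x m.
exists (cproj b u); last by rewrite cresE.
exists u => //; apply: (le_split (joinxC (P x))).
  apply: (Pcproj _ x); last exact: leIr.
  by apply: cproj_consistent (leIr _ _) _.
apply: (Pcproj _ m); last by rewrite mb leIl.
by apply: cproj_consistent (leIr _ _) _.
Qed.

Lemma tmem_cfull b x : tmem x (cfull X b) = b.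
Proof.
apply/eqP; rewrite eq_le; apply/andP; split.
  by have /le_tmem[] := lexx (tmem x (cfull X b)).
by apply/le_tmem; split=> //; exists (cproj b x); rewrite ?cresE.
Qed.

Lemma tmem_crestr a U x : tmem x (crestr a U) = a `&` tmem x U.
Proof.
apply/eqP; rewrite eq_le; apply/andP; split.
  set b := tmem _ _; have /le_tmem[/= bU [_ [u Uu <-]]] := lexx b.
  have [w wu] := cproj_surj u; rewrite -wu cresE ?leIr // cresE // => wx.
  move: bU; rewrite lexI => /andP[ba bU]; rewrite lexI ba; apply/le_tmem.
  by split=> //; exists u; rewrite // -wu cresE.
set b := a `&` _; have /le_tmem[bU [u Uu ux]] : b <= tmem x U by exact: leIr.
apply/le_tmem; have bU' : b <= a `&` csub_on U by rewrite lexI leIl.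
split=> //; exists (cres (a `&` csub_on U) u); first by exists u.
by rewrite -ux; have [w <-] := cproj_surj u; rewrite cresE ?leIr // !cresE.
Qed.

Lemma tmem_bsup_ext (F : set (csub X)) :
  extensional (fun x => bsup [set tmem x U | U in F]).
Proof.
move=> x y; rewrite leI_impl; apply: (bsup_le Ac) => _ [U FU <-].
rewrite -leI_impl; apply: le_trans (tmem_ext U x y) _.
by apply: (le_bsup Ac); exists U.
Qed.

(** [csub_of] turns the pointwise supremum into a conditional subset [H], which is a least upper
    bound for [csubset] and hence the only one. *)
Lemma is_cjoinP (F : set (csub X)) G : is_cjoin F G <->
  forall x, tmem x G = bsup [set tmem x U | U in F].
Proof.
have [H HE] := csub_of (@tmem_bsup_ext F).
have HF U : F U -> csubset U H.
  by move=> FU; apply/csubsetP => x; rewrite HE; apply: (le_bsup Ac); exists U.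
have Hmin K : (forall U, F U -> csubset U K) -> csubset H K.
  move=> FK; apply/csubsetP => x; rewrite HE; apply: (bsup_le Ac) => _ [U FU <-].
  by have /csubsetP := FK U FU; apply.
split=> [[GF Gmin] x|GE].
  rewrite -HE; apply/eqP; rewrite eq_le; apply/andP; split.
    by have /csubsetP := Gmin _ HF; apply.
  by have /csubsetP := Hmin _ GF; apply.
suff -> : G = H by [].
by apply: csub_ext => x; rewrite GE HE.
Qed.

Lemma tmem_meet_ext U V : extensional (fun x => tmem x U `&` tmem x V).
Proof.
move=> x y; rewrite lexI; apply/andP; split.
  by apply: le_trans (tmem_ext U x y); apply: leI2 => //; exact: leIl.
by apply: le_trans (tmem_ext V x y); apply: leI2 => //; exact: leIr.
Qed.

Lemma is_cmeetP U V W : is_cmeet U V W <->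
  forall x, tmem x W = tmem x U `&` tmem x V.
Proof.
have [H HE] := csub_of (@tmem_meet_ext U V).
have HU : csubset H U by apply/csubsetP => x; rewrite HE leIl.
have HV : csubset H V by apply/csubsetP => x; rewrite HE leIr.
have Hmax K : csubset K U -> csubset K V -> csubset K H.
  by move=> /csubsetP KU /csubsetP KV; apply/csubsetP => x; rewrite HE lexI KU KV.
split=> [[WU WV Wmax] x|WE].
  rewrite -HE; apply/eqP; rewrite eq_le; apply/andP; split.
    by have /csubsetP := Hmax _ WU WV; apply.
  by have /csubsetP := Wmax _ HU HV; apply.
suff -> : W = H by split.
by apply: csub_ext => x; rewrite WE HE.
Qed.

Lemma csub_join (F : set (csub X)) : exists G, is_cjoin F G.
Proof.
by have [G GE] := csub_of (@tmem_bsup_ext F); exists G; apply/is_cjoinP.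
Qed.

Lemma csub_meet U V : exists W, is_cmeet U V W.
Proof.
by have [W WE] := csub_of (@tmem_meet_ext U V); exists W; apply/is_cmeetP.
Qed.

(** Gluing [y] on [a] with the global member [x0] outside [a] turns membership to some degree into
    full membership. *)
Lemma cmem_extend U a x0 y : cmem x0 U -> a <= tmem y U ->
  exists2 z, cmem z U & a <= teq z y.
Proof.
move=> /tmemP x0U yU; have [z [z1 z2]] := cglue2 a y x0.
have {}z1 : a <= teq y z by apply/le_teq.
have {}z2 : ~` a <= teq x0 z by apply/le_teq.
exists z; last by rewrite teqC.
apply/tmemP/eqP; rewrite -le1x -(joinxC a) leUx (le_tmem_teq z1 yU).
by apply: (le_tmem_teq z2); rewrite x0U lex1.
Qed.

End TruthValues.

(** * Filters and conditional topologies *)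

Section Filters.
Context d (A : ctbDistrLatticeType d) (Ac : complete A).

Lemma le_partition I (c : I -> A) (a b : A) : partition_of \top c ->
  (forall i, c i `&` a <= b) -> a <= b.
Proof.
move=> [[_ lub] _] cab; rewrite -(meet1x a) leI_impl.
by apply: lub => _ [i _ <-]; rewrite -leI_impl.
Qed.

(* A filter on E in the A-valued sense: F P is the truth value of P \in F. *)
Record Afilter (E : Type) (F : (E -> A) -> A) : Prop := {
  filter_le : forall P Q, (forall e, P e <= Q e) -> F P <= F Q;
  filter_meet : forall P Q, F P `&` F Q <= F (fun e => P e `&` Q e);
  filter_const : forall a, a <= F (fun=> a) }.

(** The implication only has to hold on [a], because constants enter the filter with at least their
    own value. *)
Lemma filter_imp E (F : (E -> A) -> A) a P Q : Afilter F ->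
  (forall e, a `&` P e <= Q e) -> a `&` F P <= F Q.
Proof.
move=> FF aPQ; apply: le_trans (filter_le FF aPQ).
apply: le_trans (filter_meet FF _ _).
by apply: leI2 => //; exact: filter_const.
Qed.

(* The finest conditional topology for which g converges to x0 along F. *)
Definition conv_top (X : condSet A) E (F : (E -> A) -> A) (g : E -> X \top)
    (x0 : X \top) : set (csub X) :=
  [set W | tmem x0 W <= F (fun e => tmem (g e) W)].

(** Meets follow from [filter_meet], joins from monotonicity, and gluing from [filter_imp] on each
    piece of the partition. *)
Lemma conv_top_ctop (X : condSet A) E F (g : E -> X \top) (x0 : X \top) :
  Afilter F -> is_ctop (conv_top F g x0).
Proof.
move=> FF; rewrite /conv_top; split=> /=.
- by rewrite tmem_cfull.
- apply: le_trans (filter_const FF _) (filter_le FF _) => e.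
  by rewrite !tmem_cfull.
- move=> I c O G pc TO GO; apply: (le_partition pc) => i.
  have GE x : c i `&` tmem x G = c i `&` tmem x (O i).
    by rewrite -!tmem_crestr // GO.
  rewrite GE; have -> : c i `&` tmem x0 (O i) = c i `&` (c i `&` tmem x0 (O i)).
    by rewrite meetA meetxx.
  apply: le_trans (filter_imp FF (a := c i) (P := fun e => tmem (g e) (O i)) _).
    by apply: leI2 => //; apply: le_trans (TO i); exact: leIr.
  by move=> e; rewrite -GE leIr.
- move=> U V W TU TV /(is_cmeetP Ac) WE; rewrite WE.
  apply: le_trans (leI2 TU TV) _; apply: le_trans (filter_meet FF _ _) _.
  by apply: filter_le => // e; rewrite WE.
- move=> S G ST /(is_cjoinP Ac) GE; rewrite GE.
  apply: (bsup_le Ac) => _ [U SU <-]; apply: le_trans (ST _ SU) _.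
  by apply: filter_le => // e; rewrite GE; apply: (le_bsup Ac); exists U.
Qed.

End Filters.

(** * Preimages, final topologies and continuity *)

Section Continuity.
Context d (A : ctbDistrLatticeType d) (Ac : complete A).
Implicit Types X Y Z : condSet A.

Lemma teq_cfun X Y (f : cfun X Y) x y : teq x y <= teq (f \top x) (f \top y).
Proof.
by apply/(le_teq Ac); rewrite -!cfunE; congr (f _ _); apply/(le_teq Ac).
Qed.

Lemma is_cpreimageP X Y (f : cfun X Y) O P : is_cpreimage f O P <->
  forall x, tmem x P = tmem (f \top x) O.
Proof.
split=> [PE x|PE a y].
  apply/eqP; rewrite eq_le; apply/andP; split; apply/(le_tmem Ac).
    by rewrite -cfunE; apply/PE/(le_tmem Ac).
  by apply/PE; rewrite cfunE; apply/(le_tmem Ac).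
have [x <-] := cproj_surj y; rewrite cfunE.
by split=> /(le_tmem Ac) ax; apply/(le_tmem Ac); rewrite ?PE // -PE.
Qed.

Lemma cpreimage_ex X Y (f : cfun X Y) (O : csub Y) :
  exists P, is_cpreimage f O P.
Proof.
have [|P PE] := csub_of Ac (P := fun x => tmem (f \top x) O).
  move=> x y; apply: le_trans (tmem_ext Ac O (f \top x) (f \top y)).
  by apply: leI2 => //; exact: teq_cfun.
by exists P; apply/is_cpreimageP.
Qed.

(** The restriction is glued from [U] on [a] and the least conditional subset on the complement. *)
Lemma ctop_crestr X (T : set (csub X)) a U : is_ctop T -> T U -> T (crestr a U).
Proof.
move=> [T0 _ Tglue _ _] TU.
apply: (Tglue _ _ (fun i : bool => if i then U else cfull X \bot) _
  (partition_two a)) => -[] //=; apply: (csub_ext Ac) => x;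
  rewrite !tmem_crestr // ?tmem_cfull // meetA ?meetxx //.
by rewrite meetCx meet0x meetx0.
Qed.

Lemma ctop_cfull X (T : set (csub X)) a : is_ctop T -> T (cfull X a).
Proof.
move=> Ttop; have [_ T1 _ _ _] := Ttop.
have -> : cfull X a = crestr a (cfull X \top).
  by apply: (csub_ext Ac) => x; rewrite tmem_crestr // !tmem_cfull // meetx1.
exact: ctop_crestr.
Qed.

Definition final_top X Y (T : set (csub X)) (f : cfun X Y) : set (csub Y) :=
  [set W | exists2 P, is_cpreimage f W P & T P].

Lemma final_top_ctop X Y (T : set (csub X)) (f : cfun X Y) :
  is_ctop T -> is_ctop (final_top T f).
Proof.
move=> Ttop; have [T0 T1 Tglue Tmeet Tjoin] := Ttop; split.
- by exists (cfull X \bot) => //; apply/is_cpreimageP => x; rewrite !tmem_cfull.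
- by exists (cfull X \top) => //; apply/is_cpreimageP => x; rewrite !tmem_cfull.
- move=> I c O G pc TO GO.
  have /choice[P PP] : forall i, exists P, is_cpreimage f (O i) P /\ T P.
    by move=> i; have [P PO TP] := TO i; exists P.
  have [Q QG] := cpreimage_ex f G; exists Q => //.
  apply: (Tglue _ c P) => // [i|i]; first by case: (PP i).
  apply: (csub_ext Ac) => x.
  move/is_cpreimageP: QG => QG; have [/is_cpreimageP Pi _] := PP i.
  by rewrite !tmem_crestr // QG Pi -!tmem_crestr // GO.
- move=> U V W [P /is_cpreimageP PU TP] [Q /is_cpreimageP QV TQ].
  move=> /(is_cmeetP Ac) WE; have [S SW] := cpreimage_ex f W; exists S => //.
  apply: Tmeet TP TQ _; apply/(is_cmeetP Ac) => x.
  by move/is_cpreimageP: SW => ->; rewrite WE PU QV.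
- move=> F G FT /(is_cjoinP Ac) GE.
  (* The preimage of a join is the join of the preimages, which [F'] collects. *)
  pose F' := [set P | T P /\ exists2 U, F U & is_cpreimage f U P].
  have [P PF'] := csub_join Ac F'; exists P; last first.
    by apply: Tjoin PF' => Q [].
  move/(is_cjoinP Ac): PF' => PE; apply/is_cpreimageP => x; rewrite PE GE.
  apply/eqP; rewrite eq_le; apply/andP; split; apply: (bsup_le Ac).
    move=> _ [Q [_ [U FU /is_cpreimageP QU]] <-]; rewrite QU.
    by apply: (le_bsup Ac); exists U.
  move=> _ [U FU <-]; have [Q QU TQ] := FT U FU.
  have /is_cpreimageP <- := QU.
  by apply: (le_bsup Ac); exists Q => //; split=> //; exists U.
Qed.

Definition ccomp X Y Z (g : cfun Y Z) (f : cfun X Y) : cfun X Z.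
Proof. by exists (fun a x => g a (f a x)) => a x; rewrite !cfunE. Defined.

Definition cconst X Y (y : Y \top) : cfun X Y.
Proof. by exists (fun a _ => cproj a y) => a x; rewrite cproj_top. Defined.

Definition cid_fun X : cfun X X := @Cfun d A X X (fun a x => x) (fun a x => erefl).

Definition cpair X Y Z (f : cfun X Y) (g : cfun X Z) : cfun X (cprod Y Z).
Proof. by exists (fun a x => (f a x, g a x)) => a x; rewrite !cfunE. Defined.

Lemma ccontinuous_comp X Y Z TX TY TZ (g : cfun Y Z) (f : cfun X Y) :
  ccontinuous TY TZ g -> ccontinuous TX TY f -> ccontinuous TX TZ (ccomp g f).
Proof.
move=> gc fc O /gc[P PO /fc[Q QP TQ]]; exists Q => // a x.
by rewrite QP PO.
Qed.

Lemma ccontinuous_const X Y TX TY (y : Y \top) :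
  is_ctop TX -> ccontinuous TX TY (cconst X y).
Proof.
move=> TXtop O _; exists (cfull X (tmem y O)); last exact: ctop_cfull.
by apply/is_cpreimageP => x; rewrite tmem_cfull //= cproj_top.
Qed.

Lemma ccontinuous_id X TX : ccontinuous TX TX (cid_fun X).
Proof. by move=> O TO; exists O. Qed.

(** [cprod_top] is an intersection of topologies, and the final topology of [cpair f g] is one of
    them; this comparison avoids describing the opens of the product. *)
Lemma ccontinuous_pair X Y Z TX TY TZ (f : cfun X Y) (g : cfun X Z) :
  is_ctop TX -> ccontinuous TX TY f -> ccontinuous TX TZ g ->
  ccontinuous TX (cprod_top TY TZ) (cpair f g).
Proof.
move=> TXtop fc gc W WT.
suff : final_top TX (cpair f g) W by [].
apply: WT; split; first exact: final_top_ctop.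
- move=> O /fc[P PO TP]; have [Q QO] := cpreimage_ex (cfst Y Z) O.
  by exists Q => //; exists P => // a x; rewrite QO PO.
- move=> O /gc[P PO TP]; have [Q QO] := cpreimage_ex (csnd Y Z) O.
  by exists Q => //; exists P => // a x; rewrite QO PO.
Qed.

(** Continuity for [conv_top] reduces to convergence of the images along [F]. This serves to compare
    product and weak topologies with convergence topologies. *)
Lemma ccontinuous_conv X Y TY (f : cfun X Y) E F (g : E -> X \top) x0 :
  (forall O, TY O ->
    tmem (f \top x0) O <= F (fun e => tmem (f \top (g e)) O)) ->
  ccontinuous (conv_top F g x0) TY f.
Proof.
move=> conv O /conv TO; have [P PO] := cpreimage_ex f O; exists P => //.
move/is_cpreimageP: PO => PO; rewrite /conv_top /= PO.
by rewrite (_ : (fun e => _) = fun e => tmem (f \top (g e)) O) //; apply/funext.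
Qed.

End Continuity.

(** * Boolean-valued ultrafilters *)

Section Ultrafilters.
Context d (A : ctbDistrLatticeType d) (Ac : complete A) (E : Type).
Implicit Types (P Q : E -> A) (m : (E -> A) -> A).

(** The analogue of a sublinear functional, with join as addition and meet with an element of [A] as
    scaling. The last two clauses and monotonicity give homogeneity. *)
Record Asublinear m : Prop := {
  sublinear_le : forall P Q, (forall e, P e <= Q e) -> m P <= m Q;
  sublinearU : forall P Q, m (fun e => P e `|` Q e) <= m P `|` m Q;
  le_sublinearZ : forall a P, a `&` m P <= m (fun e => a `&` P e);
  sublinearZ_le : forall a P, m (fun e => a `&` P e) <= a }.

(** Join distributes over infima: residuation removes one side at a time. *)
Lemma le_join_bforall (I : Type) (p q : I -> A) (x : A) :
  (forall i j, x <= p i `|` q j) -> x <= bforall p `|` bforall q.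
Proof.
move=> xpq; rewrite joinC -[bforall q]complK -leI_impl; apply: (le_bforall Ac) => i.
rewrite leI_impl complK joinC -[p i]complK -leI_impl; apply: (le_bforall Ac) => j.
by rewrite leI_impl complK.
Qed.

(* As in the Hahn-Banach theorem, a minimal sublinear map is linear. *)
Lemma minimal_sublinear m0 : Asublinear m0 ->
  exists m, [/\ Asublinear m, forall P, m P <= m0 P,
    m (fun=> \top) = m0 (fun=> \top) &
    forall P Q, m P `&` m Q <= m (fun e => P e `&` Q e)].
Proof.
move=> m0s; pose b := m0 (fun=> \top).
(* Keeping the value at \top above [b] prevents a minimal map from collapsing to zero. The order [R]
   below is reversed, so that Zorn's lemma yields a minimal map. *)
pose good m := [/\ Asublinear m, forall P, m P <= m0 P & b <= m (fun=> \top)].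
pose R (m m' : {m | good m}) := `[< forall P, sval m' P <= sval m P >].
have m0good : good m0 by split.
have [|m m' m''|m m'|C Ctot|[m mgood] mmin] := @Zorn {m | good m} R.
- by move=> m; apply/asboolP.
- by move=> /asboolP mm' /asboolP m'm''; apply/asboolP => P; apply: le_trans (mm' P).
- move=> /asboolP mm' /asboolP m'm; apply: eq_sig_hprop => [?|].
    exact: Prop_irrelevance.
  apply/funext => P.
  by apply/eqP; rewrite eq_le mm' m'm.
- have [[k1 Ck1]|C0] := pselect (exists k, C k); last first.
    by exists (exist _ m0 m0good) => m Cm; exfalso; apply: C0; exists m.
  (* The pointwise infimum bounds a non-empty chain; comparability of any two members preserves
     subadditivity. *)
  pose n P := bforall (fun i : {k | C k} => sval (sval i) P).
  have n_le P k (Ck : C k) : n P <= sval k P.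
    exact: (bforall_le Ac (fun i : {k | C k} => sval (sval i) P) (exist _ k Ck)).
  have le_n P a : (forall k, C k -> a <= sval k P) -> a <= n P.
    by move=> am; apply: (le_bforall Ac) => -[m Cm]; exact: am.
  have ngood : good n.
    split; last 1 first.
    + by apply: le_n => m Cm; case: (svalP m).
    + split=> [P Q PQ|P Q|a P|a P].
      * apply: le_n => m Cm; apply: le_trans (n_le P _ Cm) _.
        by case: (svalP m) => ms _ _; apply: sublinear_le.
      * apply: le_join_bforall => -[m Cm] [m' Cm'] /=.
        have : exists k, [/\ C k, forall S, sval k S <= sval m S &
            forall S, sval k S <= sval m' S].
          have [/asboolP mm'|/asboolP m'm] := Ctot _ _ Cm Cm'.
            by exists m'; split.
          by exists m; split.
        case=> k [Ck km km']; apply: le_trans (n_le _ _ Ck) _.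
        case: (svalP k) => ks _ _; apply: le_trans (sublinearU ks _ _) _.
        exact: leU2.
      * apply: le_n => m Cm; case: (svalP m) => ms _ _.
        by apply: le_trans (le_sublinearZ ms _ _); apply: leI2 => //; exact: n_le.
      * apply: le_trans (n_le _ _ Ck1) _.
        by case: (svalP k1) => ms _ _; exact: sublinearZ_le.
    + move=> P; apply: le_trans (n_le _ _ Ck1) _.
      by case: (svalP k1).
  exists (exist _ n ngood) => m Cm; apply/asboolP => P; exact: n_le.
- have [ms mm0 bm] := mgood.
  have mT P : m P <= m (fun=> \top) by apply: (sublinear_le ms) => e; exact: lex1.
  exists m; split=> // [|P Q].
    by apply/eqP; rewrite eq_le mm0.
  (* This competitor is sublinear, lies below [m] and keeps the value at \top, so minimality makes
     it equal to [m]. Below [m P] it reduces to the value of [m] at the meet of [P] and [S]. *)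
  pose n S := m (fun e => P e `&` S e) `|` (~` m P `&` m S).
  have nm S : n S <= m S.
    rewrite leUx leIr andbT; apply: (sublinear_le ms) => e; exact: leIr.
  have ngood : good n.
    split=> [|S|]; last 1 first.
    + apply: le_trans bm _; rewrite /n.
      have -> : (fun e => P e `&` \top) = P by apply/funext => e; rewrite meetx1.
      by rewrite joinIr joinxC meet1x leUr.
    + split=> [S S' SS'|S S'|a S|a S].
      * apply: leU2; first by apply: (sublinear_le ms) => e; exact: leI2.
        by apply: leI2 => //; apply: (sublinear_le ms).
      * rewrite /n joinACA; apply: leU2.
          apply: le_trans (sublinearU ms _ _).
          by apply: (sublinear_le ms) => e; rewrite meetUr.
        by rewrite -meetUr; apply: leI2 => //; exact: sublinearU.
      * rewrite meetUr; apply: leU2.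
          apply: le_trans (le_sublinearZ ms _ _) _.
          by apply: (sublinear_le ms) => e; rewrite meetCA.
        by rewrite meetCA; apply: leI2 => //; exact: le_sublinearZ.
      * exact: le_trans (nm _) (sublinearZ_le ms _ _).
    + exact: le_trans (nm S) (mm0 S).
  have /(congr1 sval) /= nmE : exist _ n ngood = exist _ m mgood.
    by apply: mmin; apply/asboolP.
  have : m P `&` m Q <= m P `&` n Q by rewrite nmE.
  move=> /le_trans; apply; rewrite /n meetUr leUx leIr /=.
  by rewrite meetA meetxC meet0x le0x.
Qed.

(* The ideal generated by the directed family N is proper only off the value
   [bexists (fun t => bforall (N t))]; on it, h is evaluation at e0. *)
Lemma ultrafilter_ex (e0 : E) (T : Type) (t0 : T) (N : T -> E -> A) :
  (forall s t, exists u, forall e, N s e `|` N t e <= N u e) ->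
  exists h, [/\ Afilter h, forall P, h P `|` h (fun e => ~` P e) = \top,
    forall a, h (fun=> a) = a &
    forall t, h (N t) <= bexists (fun t => bforall (N t))].
Proof.
move=> Ndir; set g := bexists _.
(* [m0 P] is the truth value of the claim that no [N t] contains [P]. Directedness of [N] makes it
   subadditive. *)
pose m0 P := bforall (fun t => bexists (fun e => P e `&` ~` N t e)).
have m0_le P t : m0 P <= bexists (fun e => P e `&` ~` N t e).
  exact: (bforall_le Ac (fun t => bexists (fun e => P e `&` ~` N t e))).
have m0s : Asublinear m0.
  split=> [P Q PQ|P Q|a P|a P].
  - apply: (le_bforall Ac) => t; apply: le_trans (m0_le P t) _.
    by apply: (bexistsS Ac) => e; apply: leI2.
  - apply: le_join_bforall => s t; have [u stu] := Ndir s t.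
    apply: le_trans (m0_le _ u) _; apply: (bexists_le Ac) => e.
    have /andP[su tu] : (N s e <= N u e) && (N t e <= N u e) by rewrite -leUx.
    rewrite meetUl; apply: leU2.
      apply: le_trans (le_bexists Ac _ e).
      by apply: leI2 => //; rewrite leC.
    apply: le_trans (le_bexists Ac _ e).
    by apply: leI2 => //; rewrite leC.
  - apply: (le_bforall Ac) => t.
    apply: le_trans (leI2 (lexx a) (m0_le P t)) _.
    apply: (meet_bexists_le Ac) => e; rewrite meetA.
    exact: (le_bexists Ac (fun e => a `&` P e `&` ~` N t e)).
  - apply: le_trans (m0_le _ t0) _; apply: (bexists_le Ac) => e.
    by rewrite -meetA leIl.
have m01 : m0 (fun=> \top) = ~` g.
  rewrite /m0 /bforall /g; congr (~` bexists _); apply/funext => t.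
  by congr (~` bexists _); apply/funext => e; rewrite meet1x.
have [m [ms mm0 m1 mI]] := minimal_sublinear m0s; rewrite m01 in m1.
have mg P : m P <= ~` g by rewrite -m1; apply: (sublinear_le ms) => e; exact: lex1.
exists (fun P => m P `|` (g `&` P e0)); split.
- split=> [P Q PQ|P Q|a].
  + by apply: leU2; [exact: sublinear_le|apply: leI2].
  (* The mixed terms vanish, because [m] only takes values below the complement of [g]. *)
  + rewrite meetUl !meetUr !leUx; apply/andP; split; apply/andP; split.
    * exact: le_trans (mI _ _) (leUl _ _).
    * apply: (meet_le_bot (b := g)); first by rewrite meetCA leIl.
      by apply: le_trans (mg P); exact: leIl.
    * apply: (meet_le_bot (b := g)); first by rewrite -meetA leIl.
      by apply: le_trans (mg Q); exact: leIr.
    * by rewrite meetACA meetxx leUr.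
  + apply: (le_split (joinxC g)).
      by rewrite meetC leUr.
    rewrite -m1; apply: le_trans (le_sublinearZ ms _ _) _.
    apply: le_trans (leUl _ _); apply: (sublinear_le ms) => e.
    exact: leIl.
- move=> P; apply/eqP; rewrite -le1x joinACA -meetUr joinxC meetx1.
  rewrite -(joinCx g) leUx leUr andbT; apply: le_trans (leUl _ _).
  rewrite -m1; apply: le_trans (sublinearU ms _ _).
  by apply: (sublinear_le ms) => e; rewrite joinxC.
- move=> a; apply/eqP; rewrite eq_le; apply/andP; split.
    rewrite leUx leIr andbT.
    apply: le_trans (sublinearZ_le ms a (fun=> \top)).
    by apply: (sublinear_le ms) => e; rewrite meetx1.
  apply: (le_split (joinxC g)); first by rewrite meetC leUr.
  rewrite -m1; apply: le_trans (le_sublinearZ ms _ _) _.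
  apply: le_trans (leUl _ _); apply: (sublinear_le ms) => e.
  exact: leIl.
(* [m0 (N t)] is \bot, since [N t] contains itself; only the part of [h] below [g] remains. *)
- move=> t; rewrite leUx leIl andbT; apply: le_trans (mm0 _) _.
  apply: le_trans (m0_le _ t) _; apply: (bexists_le Ac) => e.
  by rewrite meetxC le0x.
Qed.

End Ultrafilters.

(** * Conditional real numbers *)

(* R_1 as a type of its own, so that it can carry a ring structure. *)
Definition rtop d (A : ctbDistrLatticeType d) (R : condReal A) : Type := R \top.

Section RealRing.
Context d (A : ctbDistrLatticeType d) (R : condReal A).

HB.instance Definition _ := gen_eqMixin (rtop R).
HB.instance Definition _ := gen_choiceMixin (rtop R).

Lemma radd0r : left_id (rzero : rtop R) radd.
Proof. by move=> x; rewrite raddC radd0. Qed.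

Lemma raddNr : left_inverse (rzero : rtop R) ropp radd.
Proof. by move=> x; rewrite raddC raddN. Qed.

HB.instance Definition _ := GRing.isZmodule.Build (rtop R)
  (@raddA _ _ R) (@raddC _ _ R) radd0r raddNr.

Lemma rmul1r : left_id (rone : rtop R) rmul.
Proof. by move=> x; rewrite rmulC rmul1. Qed.

Lemma rmulDl : left_distributive (rmul : rtop R -> rtop R -> rtop R) radd.
Proof. by move=> x y z; rewrite rmulC rmulDr !(rmulC z). Qed.

HB.instance Definition _ := GRing.Zmodule_isComPzRing.Build (rtop R)
  (@rmulA _ _ R) (@rmulC _ _ R) rmul1r rmulDl.

End RealRing.

Local Notation req x y := (teq (x : rtop _) (y : rtop _)).
Local Notation rnorm x := (rabs (x : rtop _) : rtop _).

(** * The order of the conditional real numbers with values in [A] *)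

Section RealOrder.
Context d (A : ctbDistrLatticeType d) (Ac : complete A) (R : condReal A).
Implicit Types (a b c : A) (x y z t u v e : rtop R).

Definition tle x y : A := tmem ((x, y) : cprod R R \top) (rle_sub R).

Lemma le_tle a x y :
  a <= tle x y <-> rle_at (cproj a (x : R \top)) (cproj a (y : R \top)).
Proof. exact: (le_tmem Ac a ((x, y) : cprod R R \top)). Qed.

Lemma tleP x y : tle x y = \top <-> rle x y.
Proof. exact: (tmemP Ac ((x, y) : cprod R R \top)). Qed.

Lemma le_tleP x y : \top <= tle x y <-> rle x y.
Proof. by rewrite le1x; split=> [/eqP/tleP//|/tleP/eqP]. Qed.

Lemma tle_refl a x : a <= tle x x.
Proof. by apply/le_tle; exact: rle_at_refl. Qed.

Lemma teq_tle a x y : a <= req x y -> a <= tle x y.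
Proof. by move=> /(le_teq Ac) xy; apply/le_tle; rewrite xy; exact: rle_at_refl. Qed.

Lemma tle_anti a x y : a <= tle x y -> a <= tle y x -> a <= req x y.
Proof.
by move=> /le_tle xy /le_tle yx; apply/(le_teq Ac); exact: rle_at_anti.
Qed.

(* Outside a, replacing every number by 0 turns relations that hold on a into
   global ones. *)
Lemma ccut_ex a x : exists y : rtop R,
  a <= req y x /\ ~` a <= req y 0%R.
Proof.
have [y [y1 y2]] := cglue2 a (x : R \top) (rzero : R \top).
by exists y; split; apply/(le_teq Ac).
Qed.

Definition ccut a x : rtop R := projT1 (cid (ccut_ex a x)).

Lemma ccut_on a x : a <= req (ccut a x) x.
Proof. by rewrite /ccut; case: cid => y []. Qed.

Lemma ccut_off a x : ~` a <= req (ccut a x) 0%R.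
Proof. by rewrite /ccut; case: cid => y []. Qed.

Lemma tle_teq a x y x' y' : a <= req x x' -> a <= req y y' ->
  a <= tle x y -> a <= tle x' y'.
Proof.
move=> /(le_teq Ac) xx' /(le_teq Ac) yy' /le_tle xy; apply/le_tle.
by rewrite -xx' -yy'.
Qed.

(** The order axioms speak of global inequalities; through cuts, transitivity and compatibility with
    the operations become available on every [a]. *)
Lemma le_tle_ccut a x y : a <= tle x y <-> rle (ccut a x) (ccut a y).
Proof.
have x1 := ccut_on a x; have y1 := ccut_on a y.
split=> [xy|/le_tleP xy].
  apply: (rle_two (a := a)); apply/le_tle.
    by apply: tle_teq xy; rewrite teqC.
  apply: (tle_teq (x := 0%R) (y := 0%R)); last exact: tle_refl.
    by rewrite teqC //; exact: ccut_off.
  by rewrite teqC //; exact: ccut_off.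
by apply: (tle_teq x1 y1); apply: le_trans xy; exact: lex1.
Qed.

Lemma tle_trans a y x z : a <= tle x y -> a <= tle y z -> a <= tle x z.
Proof.
by move=> /le_tle_ccut xy /le_tle_ccut yz; apply/le_tle_ccut; exact: rle_trans yz.
Qed.

Lemma teqD a x y x' y' : a <= req x x' -> a <= req y y' ->
  a <= req (x + y)%R (x' + y')%R.
Proof.
move=> /(le_teq Ac) xx' /(le_teq Ac) yy'; apply/(le_teq Ac).
exact: radd_cproj.
Qed.

Lemma teqM a x y x' y' : a <= req x x' -> a <= req y y' ->
  a <= req (x * y)%R (x' * y')%R.
Proof.
move=> /(le_teq Ac) xx' /(le_teq Ac) yy'; apply/(le_teq Ac).
exact: rmul_cproj.
Qed.

Lemma teqN a x y : a <= req x y ->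
  a <= req (- x)%R (- y)%R.
Proof.
by move=> /(le_teq Ac) xy; apply/(le_teq Ac); exact: ropp_cproj.
Qed.

Lemma teq_rabs a x y : a <= req x y ->
  a <= req (rnorm x) (rnorm y).
Proof. by move=> /(le_teq Ac) xy; apply/(le_teq Ac); exact: rabs_cproj. Qed.

Lemma tle_add2r a z x y : a <= tle x y -> a <= tle (x + z)%R (y + z)%R.
Proof.
move=> /le_tle_ccut xy; have := rle_add (ccut a z) xy => /le_tleP xyz.
have zz := ccut_on a z.
apply: (tle_teq (teqD (ccut_on a x) zz) (teqD (ccut_on a y) zz)).
by apply: le_trans xyz; exact: lex1.
Qed.

(** An inequality depends only on the difference of its sides, so rearranging one is left to
    [ring]. *)
Lemma tle_shift a u v x y : (y - x = v - u)%R -> a <= tle u v -> a <= tle x y.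
Proof.
move=> e /(tle_add2r (x - u)%R); congr (_ <= tle _ _); first by ring.
have -> : (v + (x - u) = (v - u) + x)%R by ring.
by rewrite -e; ring.
Qed.

Lemma tleD a x y z t : a <= tle x y -> a <= tle z t ->
  a <= tle (x + z)%R (y + t)%R.
Proof.
move=> xy zt; apply: (tle_trans (tle_add2r z xy)).
by apply: tle_shift zt; ring.
Qed.

Lemma tle_mul_ge0 a x y : a <= tle 0%R x -> a <= tle 0%R y ->
  a <= tle 0%R (x * y)%R.
Proof.
have cut0 : ccut a 0%R = 0%R.
  apply/(teqP Ac)/eqP; rewrite -le1x -(joinxC a) leUx ccut_on.
  exact: ccut_off.
move=> /le_tle_ccut; rewrite cut0 => x0 /le_tle_ccut; rewrite cut0 => y0.
have /le_tleP xy := rle_mul x0 y0.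
apply: (tle_teq (x := 0%R) (y := (ccut a x * ccut a y)%R)).
- by rewrite teq_refl // lex1.
- by apply: teqM; exact: ccut_on.
- by apply: le_trans xy; exact: lex1.
Qed.

Lemma tle_pmul2l a k x y : a <= tle 0%R k -> a <= tle x y ->
  a <= tle (k * x)%R (k * y)%R.
Proof.
move=> k0 xy; have d0 : a <= tle 0%R (y - x)%R by apply: tle_shift xy; ring.
by apply: tle_shift (tle_mul_ge0 k0 d0); ring.
Qed.

Lemma tle_total x y : tle x y `|` tle y x = \top.
Proof.
apply/eqP; rewrite -le1x.
have [a [xy yx]] := rle_total (x : R \top) y; rewrite -(joinxC a).
by apply: leU2; apply/le_tle.
Qed.

Lemma tle01 : (\top : A) <= tle 0%R 1%R.
Proof. by apply/le_tleP; exact: rle01. Qed.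

Lemma tle10 : tle 1%R (0%R : rtop R) = \bot.
Proof.
apply: (rone_neq0 (c := R)); apply/(le_teq Ac); apply: tle_anti => //.
by apply: le_trans tle01; exact: lex1.
Qed.

(** Strict positivity everywhere, equivalent to [rlt rzero e] by [rltP]. *)
Definition rpos e : Prop := tle e 0%R = \bot.

Lemma rltP x y : rlt (x : R \top) y <-> tle y x = \bot.
Proof.
split=> [[/le_tleP xy]|yx].
  apply; apply/(le_teq Ac); apply: tle_anti => //.
  by apply: le_trans xy; exact: lex1.
split; first by apply/tleP; rewrite -(tle_total x y) yx joinx0.
move=> a /(le_teq Ac) xy; apply/eqP; rewrite -lex0 -yx.
by apply: teq_tle; rewrite teqC.
Qed.

Lemma rpos1 : rpos 1%R. Proof. exact: tle10. Qed.

Lemma rpos_le e a : rpos e -> a <= tle 0%R e.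
Proof.
by move=> e0; apply: le_trans (lex1 a) _; rewrite -(tle_total 0%R e) e0 joinx0.
Qed.

Lemma rpos_inv e : rpos e -> exists2 t, (e * t = 1)%R & \top <= tle 0%R t.
Proof.
move=> e0; have [a ae|t et] := @rinv_ex _ _ R e.
  apply/eqP; rewrite -lex0 -e0; apply: teq_tle; exact/(le_teq Ac).
exists t => //; rewrite -(tle_total 0%R t) leUx lexx /=.
suff -> : tle t 0%R = \bot by exact: le0x.
(* Where [t <= 0], multiplication by [e] gives [1 <= 0], which has truth value \bot. *)
apply/eqP; rewrite -lex0 -tle10.
rewrite -[1%R : rtop R]/(rone) -et.
have := tle_pmul2l (rpos_le (tle t 0%R) e0) (lexx (tle t 0%R)).
by rewrite GRing.mulr0.
Qed.

Lemma rhalf_ex : exists2 t : rtop R, (t + t = 1)%R & \top <= tle 0%R t.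
Proof.
have [|t tE t0] := @rpos_inv (1 + 1)%R.
  apply/eqP; rewrite -lex0 -tle10; apply: tle_trans (lexx _).
  by apply: tle_shift (le_trans (lex1 _) tle01); ring.
by exists t => //; rewrite -tE; ring.
Qed.

(** Gluing with 1 outside [a] makes a number that is positive on [a] an admissible global radius. *)
Lemma rpos_glue a e : a <= ~` tle e 0%R ->
  exists2 e' : rtop R, rpos e' & a <= req e' e.
Proof.
move=> ae; have [e' [e1 e2]] := cglue2 a (e : R \top) (rone : R \top).
have {}e1 : a <= req e' e by apply/(le_teq Ac).
have {}e2 : ~` a <= req e' 1%R by apply/(le_teq Ac).
exists e' => //; apply/eqP; rewrite -lex0; apply: (le_split (joinxC a)).
  apply: (meet_le_bot (b := tle e 0%R)); last exact: le_trans (leIr _ _) ae.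
  apply: (tle_teq (x := e') (y := 0%R)); [|by rewrite teq_refl ?lex1|exact: leIl].
  exact: le_trans (leIr _ _) e1.
rewrite -tle10; apply: (tle_teq (x := e') (y := 0%R)).
- exact: le_trans (leIr _ _) e2.
- by rewrite teq_refl ?lex1.
- exact: leIl.
Qed.

Lemma rhalf_pos a t e : (t + t = 1)%R -> a <= ~` tle e 0%R ->
  a <= ~` tle (e * t)%R 0%R.
Proof.
move=> tt; move=> /le_trans; apply; rewrite leC.
have := tleD (lexx (tle (e * t)%R 0%R)) (lexx _).
by rewrite -GRing.mulrDr tt GRing.mulr1 GRing.addr0.
Qed.

Lemma rpos_half t e : (t + t = 1)%R -> rpos e -> rpos (e * t)%R.
Proof.
move=> tt e0; have := rhalf_pos (a := \top) tt (e := e).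
rewrite e0 compl0 => /(_ (lexx _)); rewrite le1x => /eqP e1.
by rewrite /rpos -[tle _ _]complK e1 compl1.
Qed.

Lemma tle_half_le0 a t x : (t + t = 1)%R -> a <= tle x (x * t)%R ->
  a <= tle x 0%R.
Proof.
move=> tt xt; have xE : x = (x * t + x * t)%R by rewrite -GRing.mulrDr tt GRing.mulr1.
have s0 : a <= tle (x * t)%R 0%R by apply: tle_shift xt; rewrite {3}xE; ring.
by have := tleD s0 s0; rewrite -xE GRing.addr0.
Qed.

(** Where [x <= y] fails, half of [x - y] is an admissible [e]; it gives x - y <= (x - y)/2, hence x
    - y <= 0. *)
Lemma tle_approx a x y : (forall e, rpos e -> a <= tle x (y + e)%R) ->
  a <= tle x y.
Proof.
move=> xye; have [t tt _] := rhalf_ex.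
apply: (le_split (joinxC (tle x y))); first exact: leIr.
set c := a `&` _; have d0 : c <= ~` tle (x - y)%R 0%R.
  apply: le_trans (leIr _ _) _; rewrite leC; apply: tle_shift (lexx _); ring.
have [e e0 ed] := rpos_glue (rhalf_pos tt d0).
have := xye e e0 => /(le_trans (leIl a (~` tle x y))); rewrite -/c => xyc.
have {}xyc : c <= tle x (y + (x - y) * t)%R.
  apply: tle_teq xyc; first by rewrite teq_refl ?lex1.
  by apply: teqD => //; rewrite teq_refl ?lex1.
have d1 : c <= tle (x - y)%R 0%R.
  by apply: (tle_half_le0 tt); apply: tle_shift xyc; ring.
exact: meet_le_bot d1 d0.
Qed.

Lemma tle_rabs a x : a <= tle x (rnorm x) /\
  a <= tle (- x)%R (rnorm x).
Proof.
have [b [/le_tle x0 /(le_teq Ac) xb /le_tle x0' /(le_teq Ac) xb']] := rabsP (x : R \top).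
rewrite -[rzero]/(0%R : rtop R) in x0 x0'.
have xN0 : b <= tle (- x)%R 0%R by apply: tle_shift x0; ring.
have xN0' : ~` b <= tle 0%R (- x)%R by apply: tle_shift x0'; ring.
split; apply: (le_split (joinxC b)); (apply: le_trans (leIr _ _) _).
- by apply: teq_tle; rewrite teqC.
- apply: (tle_trans x0'); apply: (tle_trans xN0').
  by apply: teq_tle; rewrite teqC.
- apply: (tle_trans xN0); apply: (tle_trans x0).
  by apply: teq_tle; rewrite teqC.
- by apply: teq_tle; rewrite teqC.
Qed.

Lemma rabs_le a x y : a <= tle x y -> a <= tle (- x)%R y ->
  a <= tle (rnorm x) y.
Proof.
move=> xy xNy; have [b [_ /(le_teq Ac) xb _ /(le_teq Ac) xb']] := rabsP (x : R \top).
apply: (le_split (joinxC b)).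
  apply: (tle_trans (y := x)); last exact: le_trans (leIl _ _) xy.
  by apply: teq_tle; exact: le_trans (leIr _ _) xb.
apply: (tle_trans (y := (- x)%R)); last exact: le_trans (leIl _ _) xNy.
by apply: teq_tle; exact: le_trans (leIr _ _) xb'.
Qed.

End RealOrder.

(** * Absolute values, balls and Euclidean open sets *)

Section Norm.
Context d (A : ctbDistrLatticeType d) (Ac : complete A) (R : condReal A).
Implicit Types (a b c : A) (k x y z e : rtop R).

(** Distances are split into one-sided inequalities, which [tleD] and [tle_shift] combine
    linearly. *)
Lemma rnorm_near a x y e : a <= tle (rnorm (x - y)%R) e ->
  a <= tle x (y + e)%R /\ a <= tle y (x + e)%R.
Proof.
have [xy yx] := tle_rabs Ac a (x - y)%R => xye.
by split; [apply: (tle_shift Ac) (tle_trans Ac xy xye)|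
  apply: (tle_shift Ac) (tle_trans Ac yx xye)]; ring.
Qed.

Lemma near_rnorm a x y e : a <= tle x (y + e)%R -> a <= tle y (x + e)%R ->
  a <= tle (rnorm (x - y)%R) e.
Proof.
move=> xy yx; apply: (rabs_le Ac); [apply: (tle_shift Ac) xy|apply: (tle_shift Ac) yx];
  ring.
Qed.

Lemma rnorm_ge0 a x : a <= tle 0%R (rnorm x).
Proof.
have [x1 x2] := tle_rabs Ac a x.
apply: (le_split (tle_total Ac 0%R x)).
  by apply: (tle_trans Ac (leIr _ _)); exact: le_trans (leIl _ _) x1.
apply: (tle_trans Ac (y := (- x)%R)); last exact: le_trans (leIl _ _) x2.
by apply: (tle_shift Ac) (leIr _ _); ring.
Qed.

(** Both [x] and its negative are bounded by [y], so [aux] only splits on the sign of [k]. *)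
Lemma rnormM_le a k x y : a <= tle (rnorm x) y ->
  a <= tle (rnorm (k * x)%R) (rnorm k * y)%R.
Proof.
move=> xy; have y0 := tle_trans Ac (rnorm_ge0 a x) xy.
have aux z : a <= tle z y -> a <= tle (- z)%R y -> a <= tle (k * z)%R (rnorm k * y)%R.
  have [k1 k2] := tle_rabs Ac a k => zy zNy.
  apply: (le_split (tle_total Ac 0%R k)); set b := a `&` _.
    have ba : b <= a by exact: leIl.
    apply: (tle_trans Ac (tle_pmul2l Ac (leIr _ _) (le_trans ba zy))).
    rewrite GRing.mulrC (GRing.mulrC (rnorm k)).
    by apply: (tle_pmul2l Ac); exact: le_trans ba _.
  have ba : b <= a by exact: leIl.
  have Nk : b <= tle 0%R (- k)%R by apply: (tle_shift Ac) (leIr _ _); ring.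
  rewrite -GRing.mulrNN; apply: (tle_trans Ac (tle_pmul2l Ac Nk (le_trans ba zNy))).
  rewrite GRing.mulrC (GRing.mulrC (rnorm k)).
  by apply: (tle_pmul2l Ac); exact: le_trans ba _.
have [x1 x2] := tle_rabs Ac a x.
apply: (rabs_le Ac); first by apply: aux; exact: (tle_trans Ac _ xy).
rewrite -GRing.mulrN; apply: aux; first exact: (tle_trans Ac _ xy).
by rewrite GRing.opprK; exact: (tle_trans Ac _ xy).
Qed.

Lemma tmem_ball x e (e0 : rlt rzero (e : R \top)) y :
  tmem (y : R \top) (ball (x : R \top) e0) = ~` tle e (rnorm (x - y)%R).
Proof.
apply/eqP; rewrite eq_le; apply/andP; split.
  set b := tmem _ _; have /(le_tmem Ac)[_ [u xu uy]] := lexx b.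
  rewrite cres_top in uy; move/(le_teq Ac): uy => uy.
  have /(rltP Ac) exu := xu.
  apply: le_compl_bot; rewrite -exu.
  apply: (tle_trans Ac (leIr _ _)); apply: (teq_tle Ac); apply: (teq_rabs Ac).
  apply: (teqD Ac); first by rewrite teq_refl ?lex1.
  by apply: (teqN Ac); rewrite teqC //; exact: le_trans (leIl _ _) uy.
(* A global member of the ball: [y] where it is close to [x], the centre elsewhere. *)
set b := ~` _; have [u [u1 u2]] := cglue2 b (y : R \top) x.
have {}u1 : b <= req u y by apply/(le_teq Ac).
have {}u2 : ~` b <= req u x by apply/(le_teq Ac).
apply/(le_tmem Ac); split; first exact: lex1.
exists u; last by rewrite cres_top; apply/(le_teq Ac).
apply/(rltP Ac)/eqP; rewrite -lex0; set c := tle _ _.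
have close z : c `&` req u z <= tle e (rnorm (x - z)%R).
  apply: (tle_trans Ac (leIl _ _)); apply: (teq_tle Ac); apply: (teq_rabs Ac).
  apply: (teqD Ac); first by rewrite teq_refl ?lex1.
  by apply: (teqN Ac); exact: leIr.
apply: (le_split (joinxC b)).
  apply: (meet_le_bot (b := tle e (rnorm (x - y)%R))); last exact: leIr.
  by apply: le_trans (close y); exact: leI2.
have /(rltP Ac) <- := e0.
apply: (tle_trans Ac (y := rnorm (x - x)%R)).
  by apply: le_trans (close x); exact: leI2.
rewrite GRing.subrr (_ : rnorm 0%R = 0%R); last exact: rabs0.
exact: tle_refl.
Qed.

(** The right-hand side is the truth value of the claim that some closed ball around [y] lies in
    [O]. *)
Lemma euclidean_openP (O : csub R) y : euclidean_top R O ->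
  tmem (y : R \top) O <= bexists (fun e : {e : rtop R | rpos e} =>
    bforall (fun z : rtop R =>
      ~` tle (rnorm (z - y)%R) (sval e) `|` tmem (z : R \top) O)).
Proof.
move=> [F FB /(is_cjoinP Ac) OE]; rewrite [X in X <= _]OE.
apply: (bsup_le Ac) => _ [U FU <-]; have [a [V [[x' [e' [e0 ->]]] UE]]] := FB U FU.
pose x : rtop R := x'; pose e : rtop R := e'.
have tU z : tmem (z : R \top) U = a `&` ~` tle e (rnorm (x - z)%R).
  by rewrite UE tmem_crestr // -(tmem_ball x e0).
rewrite [X in X <= _]tU; set c := _ `&` _.
(* On [c] the slack [r] is positive. The radius [s] is half of it, because the inner ball is closed
   and the outer one open: with [e <= |x - z|] one would get [r <= r/2]. *)
pose r : rtop R := (e - rnorm (x - y))%R.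
have [t tt _] := rhalf_ex Ac R.
have cr : c <= ~` tle r 0%R.
  apply: le_trans (leIr _ _) _; rewrite leC.
  by apply: (tle_shift Ac) (lexx _); rewrite /r; ring.
have [s s0 sE] := rpos_glue Ac (rhalf_pos Ac tt cr).
apply: le_trans (le_bexists Ac _ (exist _ s s0)); apply: (le_bforall Ac) => z /=.
rewrite -leI_impl; apply: (le_trans (y := tmem (z : R \top) U)); last first.
  by rewrite [X in _ <= X]OE; apply: (le_bsup Ac); exists U.
rewrite tU; set g := c `&` _; rewrite lexI; apply/andP; split.
  by rewrite /g /c -!meetA leIl.
apply: le_compl_bot; set k := g `&` _.
have kc : k <= c by rewrite /k /g -meetA leIl.
have zy : k <= tle (rnorm (z - y)%R) s by rewrite /k /g -meetA meetCA leIl.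
have exz : k <= tle e (rnorm (x - z)%R) by exact: leIr.
have [z1 z2] := rnorm_near zy.
have [y1 y2] := tle_rabs Ac k (x - y)%R.
have srt : k <= tle s (r * t)%R by apply: (teq_tle Ac); exact: le_trans kc sE.
have tri : k <= tle (rnorm (x - z)%R) (rnorm (x - y) + s)%R.
  apply: (rabs_le Ac).
    by apply: (tle_shift Ac) (tleD Ac y1 z2); ring.
  by apply: (tle_shift Ac) (tleD Ac y2 z1); ring.
apply: (meet_le_bot (b := tle r 0%R)); last exact: le_trans kc cr.
apply: (tle_half_le0 Ac tt).
have {srt} := tleD Ac (tle_refl Ac k (rnorm (x - y)%R)) srt.
move=> /(tle_trans Ac tri)/(tle_trans Ac exz); apply: (tle_shift Ac).
by rewrite /r; ring.
Qed.

End Norm.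

(** * Limits along an ultrafilter *)

Section Limits.
Context d (A : ctbDistrLatticeType d) (Ac : complete A) (R : condReal A).
Context (E : Type) (h : (E -> A) -> A) (hF : Afilter h).
Implicit Types (a b c : A) (k l m r s e : rtop R) (f g : E -> rtop R).

Lemma filter_all a (P : E -> A) : (forall i, a <= P i) -> a <= h P.
Proof. by move=> aP; apply: le_trans (filter_const hF a) (filter_le hF aP). Qed.

Lemma filter_le2 a (P Q S : E -> A) : a <= h P -> a <= h Q ->
  (forall i, P i `&` Q i <= S i) -> a <= h S.
Proof.
move=> aP aQ PQS; apply: le_trans (filter_le hF PQS).
by apply: le_trans (filter_meet hF _ _); rewrite lexI aP.
Qed.

Definition lim_along f l : Prop := forall e, rpos e ->
  h (fun i => tle (rnorm (f i - l)%R) e) = \top.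

Lemma lim_along_le f l e a : lim_along f l -> rpos e ->
  a <= h (fun i => tle (rnorm (f i - l)%R) e).
Proof. by move=> fl e0; rewrite fl // lex1. Qed.

Lemma lim_along_cst l : lim_along (fun=> l) l.
Proof.
move=> e e0; apply/eqP; rewrite -le1x; apply: filter_all => i.
rewrite GRing.subrr (_ : rnorm 0%R = 0%R); last exact: rabs0.
exact: rpos_le.
Qed.

Lemma lim_alongD f g l m : lim_along f l -> lim_along g m ->
  lim_along (fun i => f i + g i)%R (l + m)%R.
Proof.
move=> fl gm e e0; have [t tt _] := rhalf_ex Ac R.
have et := rpos_half Ac tt e0; apply/eqP; rewrite -le1x.
apply: (filter_le2 (lim_along_le _ fl et) (lim_along_le _ gm et)) => i.
have [f1 f2] := rnorm_near Ac (leIl (tle (rnorm (f i - l)%R) (e * t)%R)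
  (tle (rnorm (g i - m)%R) (e * t)%R)).
have [g1 g2] := rnorm_near Ac (leIr (tle (rnorm (g i - m)%R) (e * t)%R)
  (tle (rnorm (f i - l)%R) (e * t)%R)).
have eE : e = (e * t + e * t)%R by rewrite -GRing.mulrDr tt GRing.mulr1.
rewrite [X in _ <= tle _ X]eE; apply: (near_rnorm Ac).
  by apply: (tle_shift Ac) (tleD Ac f1 g1); ring.
by apply: (tle_shift Ac) (tleD Ac f2 g2); ring.
Qed.

Lemma lim_alongM k f l : lim_along f l -> lim_along (fun i => k * f i)%R (k * l)%R.
Proof.
move=> fl e e0.
(* Adding 1 makes [M] invertible even where [k] vanishes; the tolerance for [f] is then [e / M]. *)
pose M : rtop R := (rnorm k + 1)%R.
have M0 : rpos M.
  apply/eqP; rewrite -lex0 -(tle10 Ac R); apply: (tle_trans Ac _ (lexx _)).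
  by apply: (tle_shift Ac) (rnorm_ge0 Ac _ k); rewrite /M; ring.
have [t Mt t0] := rpos_inv Ac M0.
have t0' a : a <= tle 0%R t by exact: le_trans (lex1 a) t0.
have et : rpos (e * t)%R.
  apply/eqP; rewrite -lex0 -e0.
  have := tle_pmul2l Ac (rpos_le Ac (tle (e * t)%R 0%R) M0) (lexx _).
  by rewrite GRing.mulr0 GRing.mulrCA Mt GRing.mulr1.
apply/eqP; rewrite -le1x -(fl _ et); apply: filter_le => // i.
rewrite -GRing.mulrBr; set a := tle _ _.
apply: (tle_trans Ac (rnormM_le Ac k (lexx a))).
have eE : e = (M * (e * t))%R by rewrite GRing.mulrCA Mt GRing.mulr1.
rewrite [X in _ <= tle _ X]eE /M GRing.mulrDl GRing.mul1r.
by apply: (tle_shift Ac) (rpos_le Ac a et); ring.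
Qed.

Hypothesis hC : forall a, h (fun=> a) = a.

(** The inequality [l <= m + e] does not depend on the index, so by [hC] its value under [h] is its
    truth value; it follows from two approximations within [e/2]. *)
Lemma lim_along_mono a f g l m : lim_along f l -> lim_along g m ->
  a <= h (fun i => tle (f i) (g i)) -> a <= tle l m.
Proof.
move=> fl gm fg; apply: (tle_approx Ac) => e e0; have [t tt _] := rhalf_ex Ac R.
have et := rpos_half Ac tt e0; rewrite -[X in _ <= X]hC.
have := filter_le2 (lim_along_le a fl et) (lim_along_le a gm et)
  (fun i => lexx _).
move=> /filter_le2 - /(_ _ _ fg); apply => i; set b := _ `&` _.
have [_ f2] : b <= tle (f i) (l + e * t)%R /\ b <= tle l (f i + e * t)%R.
  by apply: (rnorm_near Ac); rewrite /b -!meetA leIl.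
have [g1 _] : b <= tle (g i) (m + e * t)%R /\ b <= tle m (g i + e * t)%R.
  by apply: (rnorm_near Ac); rewrite /b meetAC leIr.
have fgi : b <= tle (f i) (g i) by exact: leIr.
have eE : e = (e * t + e * t)%R by rewrite -GRing.mulrDr tt GRing.mulr1.
rewrite [X in _ <= tle _ (_ + X)%R]eE.
by apply: (tle_shift Ac) (tleD Ac f2 (tleD Ac fgi g1)); ring.
Qed.

Lemma lim_along_teq a f g l m : lim_along f l -> lim_along g m ->
  (forall i, a <= req (f i) (g i)) -> a <= req l m.
Proof.
move=> fl gm fg; apply: (tle_anti Ac).
  by apply: lim_along_mono fl gm _; apply: filter_all => i; exact: (teq_tle Ac).
apply: lim_along_mono gm fl _; apply: filter_all => i.
by apply: (teq_tle Ac); rewrite teqC.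
Qed.

Lemma lim_along_unique f l m : lim_along f l -> lim_along f m -> l = m.
Proof.
move=> fl fm; apply/(teqP (X := rset R) Ac)/eqP; rewrite -le1x.
by apply: lim_along_teq fl fm _ => i; rewrite teq_refl.
Qed.

(** With the given truth value a ball around [l] lies in [O], and [f] is in that ball almost
    everywhere. *)
Lemma lim_along_open f l (O : csub R) : lim_along f l -> euclidean_top R O ->
  tmem (l : R \top) O <= h (fun i => tmem (f i : R \top) O).
Proof.
move=> fl /(euclidean_openP Ac l)/le_trans; apply; apply: (bexists_le Ac) => -[e e0] /=.
set a := bforall _; rewrite -[a]meetx1 -(fl _ e0).
apply: (filter_imp hF) => i; rewrite leI_impl.
exact: (bforall_le Ac (fun z : rtop R =>
  ~` tle (rnorm (z - l)%R) e `|` tmem (z : R \top) O)).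
Qed.

Hypothesis hU : forall P, h P `|` h (fun i => ~` P i) = \top.

(* The limit is the supremum of the r with r <= f almost everywhere. *)
Lemma lim_along_ex k f : (forall i, \top <= tle (- k)%R (f i)) ->
  (forall i, \top <= tle (f i) k) -> exists l, lim_along f l.
Proof.
move=> kf fk.
have kf' a i : a <= tle (- k)%R (f i) by exact: le_trans (lex1 a) (kf i).
have fk' a i : a <= tle (f i) k by exact: le_trans (lex1 a) (fk i).
(* Dedekind completeness needs a conditional subset: that of the lower bounds of [f] almost
   everywhere. It lives on \top thanks to [- k]. *)
have [S SE] : exists S : csub R,
    forall r : R \top, tmem r S = h (fun i => tle (r : rtop R) (f i)).
  apply: (csub_of Ac) => r s; rewrite meetC; apply: (filter_imp hF) => i.
  apply: (tle_trans Ac (y := r : rtop R)); last exact: leIr.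
  by apply: (teq_tle Ac); rewrite teqC // leIl.
have kS : \top <= tmem ((- k)%R : rtop R) S by rewrite SE; apply: filter_all.
have Son : csub_on S = \top.
  by apply/eqP; rewrite -le1x; apply/(le_csub_on Ac); exists (- k)%R.
have [|l' [lub lmin]] := rle_dedekind Son.
  exists k => r /(tmemP Ac); rewrite SE => rf; apply/(le_tleP Ac).
  rewrite -rf -[X in _ <= X]hC; apply: filter_le => // i.
  exact: (tle_trans Ac (lexx _)).
pose l : rtop R := l'.
have Sle r : h (fun i => tle r (f i)) <= tle r l.
  (* [r] is a lower bound only with value [a]; the lower bound [- k] outside [a] makes it a global
     member of [S]. *)
  set a := h _; have [r' [r1 r2]] := cglue2 a (r : R \top) (- k : rtop R)%R.
  have {}r1 : a <= req r' r by apply/(le_teq Ac).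
  have {}r2 : ~` a <= req r' (- k)%R by apply/(le_teq Ac).
  apply: (tle_trans Ac (y := r')); first by apply: (teq_tle Ac); rewrite teqC.
  apply: le_trans (lex1 a) _; apply/(le_tleP Ac)/lub/(tmemP Ac)/eqP.
  rewrite -le1x SE -(joinxC a) leUx; apply/andP; split.
    rewrite -[X in X <= _]meetxx; apply: (filter_imp hF) => i.
    apply: (tle_trans Ac (y := r)); last exact: leIr.
    by apply: (teq_tle Ac); exact: le_trans (leIl _ _) r1.
  apply: filter_all => i; apply: (tle_trans Ac (y := (- k)%R)) => //.
  exact: (teq_tle Ac).
have leS r : h (fun i => tle (f i) r) <= tle l r.
  (* Dually, the upper bound [k] outside [a] yields a global upper bound of [S]. *)
  set a := h _; have [r' [r1 r2]] := cglue2 a (r : R \top) k.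
  have {}r1 : a <= req r' r by apply/(le_teq Ac).
  have {}r2 : ~` a <= req r' k by apply/(le_teq Ac).
  apply: (tle_trans Ac (y := r')); last exact: (teq_tle Ac).
  apply: le_trans (lex1 a) _; apply/(le_tleP Ac)/lmin => s /(tmemP Ac).
  rewrite SE => sf; apply/(le_tleP Ac); rewrite -(joinxC a) leUx; apply/andP; split.
    rewrite -[X in _ <= X]hC; apply: (@filter_le2 _ (fun i => tle s (f i))
      (fun i => a `&` tle (f i) r)); first by rewrite sf lex1.
      by rewrite -[X in X <= _]meetxx; apply: (filter_imp hF) => i.
    move=> i; apply: (tle_trans Ac (leIl _ _)).
    apply: (tle_trans Ac (y := r)); first by rewrite meetA leIr.
    apply: (teq_tle Ac); rewrite teqC //.
    by apply: le_trans r1; rewrite meetCA leIl.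
  rewrite -[X in _ <= X]hC; apply: (@filter_le2 _ (fun i => tle s (f i))
    (fun i => ~` a)); [by rewrite sf lex1|exact: filter_all|] => i.
  apply: (tle_trans Ac (leIl _ _)).
  apply: (tle_trans Ac (y := k)) => //.
  by apply: (teq_tle Ac); rewrite teqC //; exact: le_trans (leIr _ _) r2.
exists l => e e0; apply/eqP; rewrite -le1x.
(* Otherwise the ultrafilter property gives [f <= l - e] almost everywhere, hence [l <= l - e],
   against [rpos e]. *)
have below : \top <= h (fun i => tle (l - e)%R (f i)).
  rewrite -(hU (fun i => tle (l - e)%R (f i))) leUx lexx /=.
  apply: le_trans (le0x _); rewrite -e0.
  apply: le_trans (_ : h (fun i => tle (f i) (l - e)%R) <= _).
    apply: filter_le => // i.
    by rewrite leCx -[X in X <= _]meet1x -(tle_total Ac (l - e)%R (f i)) meetUl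
      leUx leIl /= meetxC le0x.
  apply: le_trans (leS _) _.
  by apply: (tle_shift Ac) (lexx _); ring.
have above : \top <= h (fun i => tle (f i) (l + e)%R).
  rewrite -(hU (fun i => tle (f i) (l + e)%R)) leUx lexx /=.
  apply: le_trans (le0x _); rewrite -e0.
  apply: le_trans (_ : h (fun i => tle (l + e)%R (f i)) <= _).
    apply: filter_le => // i.
    by rewrite leCx -[X in X <= _]meet1x -(tle_total Ac (f i) (l + e)%R) meetUl
      leUx leIl /= meetxC le0x.
  apply: le_trans (Sle _) _.
  by apply: (tle_shift Ac) (lexx _); ring.
apply: (filter_le2 below above) => i; apply: (near_rnorm Ac).
  exact: leIr.
by apply: (tle_shift Ac) (leIl _ _); ring.
Qed.

End Limits.

(** * Linear functions and neighborhoods of 0 *)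

Section LinearMaps.
Context d (A : ctbDistrLatticeType d) (Ac : complete A) (R : condReal A).

Lemma rpos_min (e e' : rtop R) : rpos e -> rpos e' ->
  exists2 m : rtop R, rpos m & \top <= tle m e /\ \top <= tle m e'.
Proof.
move=> e0 e0'; set a := tle e e'.
have [m [m1 m2]] := cglue2 a (e : R \top) e'.
have {}m1 : a <= req m e by apply/(le_teq Ac).
have {}m2 : ~` a <= req m e' by apply/(le_teq Ac).
have em : ~` a <= tle e' e.
  rewrite -[X in X <= _]meet1x -(tle_total Ac e' e) meetUl leUx leIl.
  by rewrite meetxC le0x.
exists m; last split.
- apply/eqP; rewrite -lex0; apply: (le_split (joinxC a)).
    rewrite -e0; apply: (tle_trans Ac (y := m)); last exact: leIl.
    by apply: (teq_tle Ac); rewrite teqC //; exact: le_trans (leIr _ _) m1.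
  rewrite -e0'; apply: (tle_trans Ac (y := m)); last exact: leIl.
  by apply: (teq_tle Ac); rewrite teqC //; exact: le_trans (leIr _ _) m2.
- rewrite -(joinxC a) leUx (teq_tle Ac m1).
  exact: (tle_trans Ac (teq_tle Ac m2)).
- rewrite -(joinxC a) leUx (teq_tle Ac m2) andbT.
  exact: (tle_trans Ac (teq_tle Ac m1)).
Qed.

(** The neighborhood filter of 0 in the conditional reals, valued in [A]. *)
Definition nbhs0 (P : R \top -> A) : A :=
  bexists (fun e : {e : rtop R | rpos e} =>
    bforall (fun r : rtop R => ~` tle (rnorm r) (sval e) `|` P r)).

Lemma nbhs0_filter : Afilter nbhs0.
Proof.
split=> [P Q PQ|P Q|a].
- apply: (bexistsS Ac) => e; apply: (le_bforall Ac) => r.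
  apply: le_trans (bforall_le Ac _ r) _.
  by apply: leU2.
- apply: (meet_bexists_le Ac) => -[e' e0']; rewrite meetC.
  apply: (meet_bexists_le Ac) => -[e e0] /=.
  have [m m0 [me me']] := rpos_min e0 e0'.
  apply: le_trans (le_bexists Ac _ (exist _ m m0)); apply: (le_bforall Ac) => r /=.
  rewrite -leI_impl lexI; apply/andP; split.
    rewrite leI_impl; apply: le_trans (leIr _ _) _.
    apply: le_trans (bforall_le Ac _ r) _; apply: leU2 => //.
    by rewrite leC; apply: (tle_trans Ac (lexx _)); exact: le_trans (lex1 _) me.
  rewrite leI_impl; apply: le_trans (leIl _ _) _.
  apply: le_trans (bforall_le Ac _ r) _; apply: leU2 => //.
  by rewrite leC; apply: (tle_trans Ac (lexx _)); exact: le_trans (lex1 _) me'.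
- apply: le_trans (le_bexists Ac _ (exist _ 1%R (rpos1 Ac R))).
  by apply: (le_bforall Ac) => r; exact: leUr.
Qed.

Lemma rnorm_pos a (e : rtop R) : rpos e -> a <= tle (rnorm e) e.
Proof.
move=> e0; apply: (rabs_le Ac); first exact: tle_refl.
by apply: (tle_shift Ac) (tleD Ac (rpos_le Ac a e0) (rpos_le Ac a e0)); ring.
Qed.

Lemma vadd_idem (V : condVect R) (v : V \top) : vadd v v = v -> v = vzero.
Proof.
by move=> vv; have [w vw] := vaddN v; rewrite -[LHS]vadd0 -{1}vw vaddA vv.
Qed.

Lemma vscale0 (V : condVect R) (v : V \top) : vscale rzero v = vzero.
Proof. by apply: vadd_idem; rewrite -vscaleDl radd0. Qed.

Lemma vscaler0 (V : condVect R) (k : R \top) : vscale k (vzero : V \top) = vzero.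
Proof. by apply: vadd_idem; rewrite -vscaleDr vadd0. Qed.

Section Linear.
Context (V : condVect R) (f : cfun V R) (flin : clinear f).

Lemma clinear0 : f \top vzero = 0%R :> rtop R.
Proof.
have := flin rone vzero vzero; rewrite vscale1 vadd0 rmulC rmul1.
by move=> /esym /radd_idem.
Qed.

Lemma clinearD x y : f \top (vadd x y) = ((f \top x : rtop R) + f \top y)%R :> rtop R.
Proof. by have := flin rone x y; rewrite vscale1 rmulC rmul1. Qed.

Lemma clinearZ (k : rtop R) x :
  f \top (vscale (k : R \top) x) = (k * (f \top x : rtop R))%R :> rtop R.
Proof. by have := flin k x vzero; rewrite vadd0 clinear0 radd0. Qed.

End Linear.

Section TVS.
Context (X : condTVS R).
Local Notation T := (tvs_top X).

(** By continuity of scalar multiplication, [vscale r x] tends to 0 as [r] does, so it lies in [O]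
    for small [r]. *)
Lemma open_absorbing (O : csub X) (x : X \top) : T O -> cmem (vzero : X \top) O ->
  exists2 e : rtop R, rpos e & cmem (vscale (e : R \top) x) O.
Proof.
move=> /(tvs_scale_cont (c := X))[W /(is_cpreimageP Ac) WO TW] /(tmemP Ac) O0.
pose g (r : R \top) : cprod R X \top := (r, x).
(* [W] is open in every topology with continuous projections, in particular in the convergence
   topology of [g] along [nbhs0]. *)
have /TW : [set T' | [/\ is_ctop T', ccontinuous T' (euclidean_top R) (cfst R X) &
    ccontinuous T' T (csnd R X)]] (conv_top nbhs0 g (g rzero)).
  split; first exact: (conv_top_ctop Ac _ _ nbhs0_filter).
    apply: (ccontinuous_conv Ac) => Q /= /(euclidean_openP Ac (0%R : rtop R)).
    move=> /le_trans; apply; apply: (bexistsS Ac) => e.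
    apply: (le_bforall Ac) => r; apply: le_trans (bforall_le Ac _ r) _.
    by rewrite GRing.subr0.
  apply: (ccontinuous_conv Ac) => Q TQ /=.
  exact: filter_const nbhs0_filter _.
have WE r : tmem (g r) W = tmem (vscale r x) O by exact: WO.
rewrite /conv_top /= WE vscale0 O0 => O1.
(* Combining positivity and membership lets the maximum principle select one global [e] with
   both. *)
pose P (e : R \top) := ~` tle (e : rtop R) 0%R `&` tmem (vscale e x) O.
have Pext : extensional P.
  move=> e e'; rewrite lexI; apply/andP; split.
    apply: le_compl_bot.
    set b := _ `&` _; apply: (meet_le_bot (b := tle (e : rtop R) 0%R)).
      apply: (tle_teq Ac (x := e') (y := 0%R)); last exact: leIr.
        by rewrite teqC // /b meetAC leIr.
      by rewrite teq_refl ?lex1.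
    by rewrite /b /P -!meetA leIl.
  apply: (le_tmem_teq Ac (x := vscale e x)); last by rewrite -meetA meetCA leIl.
  apply: le_trans (leIr _ _) _; apply/(le_teq Ac).
  rewrite /vscale -!copE; congr (cop _ _ _); exact/(le_teq Ac).
have [e eE] := maximum_principle Ac Pext.
have : \top <= P e.
  rewrite eE; apply: le_trans O1 _; apply: (bexists_le Ac) => -[r r0] /=.
  apply: le_trans (bforall_le Ac _ r) _; rewrite WE.
  apply: le_trans (le_bexists Ac _ (r : R \top)).
  rewrite /P r0 compl0 meet1x leUx lexx andbT.
  have := rnorm_pos \top r0; rewrite le1x => /eqP ->.
  by rewrite compl1 le0x.
rewrite lexI !le1x => /andP[e0 /eqP/(tmemP Ac) ex]; exists e => //.
by rewrite /rpos -[tle _ _]complK (eqP e0) compl1.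
Qed.

(** If [f] is bounded by 1 on an open [B] and the ball of radius [e] around [f x] lies in [O], then
    x + eB lies in the preimage of [O]. *)
Lemma bounded_ccontinuous (f : cfun X R) (U : csub X) : clinear f ->
  is_nbhs T (vzero : X \top) U ->
  (forall x : X \top, cmem x U -> rle (rabs (f \top x)) rone) ->
  ccontinuous T (euclidean_top R) f.
Proof.
move=> flin [_ [B TB [B0 /(csubsetP Ac) BU]]] fU O EO.
(* [fU] concerns global members of [U], so a point lying in [B] to some degree is first extended to
   one. *)
have fB x : tmem x B <= tle (rnorm (f \top x)) 1%R.
  have U0 : cmem (vzero : X \top) U.
    apply/(tmemP Ac)/eqP; rewrite -le1x; apply: le_trans (BU _).
    by move/(tmemP Ac): B0 => ->.
  have [z /fU/(le_tleP Ac) zU xz] := cmem_extend Ac U0 (BU x).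
  apply: (tle_trans Ac (y := rnorm (f \top z))); last exact: le_trans (lex1 _) zU.
  apply: (teq_tle Ac); apply: (teq_rabs Ac); rewrite teqC //.
  exact: le_trans xz (teq_cfun Ac f _ _).
have [P PO] := cpreimage_ex Ac f O; exists P => //.
move/(is_cpreimageP Ac): PO => PO.
have Ttop := tvs_is_top X; have [_ _ _ _ Tjoin] := Ttop.
(* The preimage is open because it is the join of the open sets inside it. *)
apply: (Tjoin [set V | T V /\ csubset V P]) => [V []//|].
apply/(is_cjoinP Ac) => x; apply/eqP; rewrite eq_le; apply/andP; split; last first.
  by apply: (bsup_le Ac) => _ [V [_ /(csubsetP Ac) VP] <-].
rewrite [X in X <= _]PO; apply: le_trans (euclidean_openP Ac _ EO) _.
apply: (bexists_le Ac) => -[e e0] /=; set a := bforall _.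
have [t et _] := rpos_inv Ac e0; have [y xy] := vaddN x.
(* With [y] the negative of [x] and [t] the inverse of [e], [s] is the map z -> (z - x)/e, and [B]
   pulls back to x + eB. *)
pose s := ccomp (vscale_fun X) (cpair (cconst X (t : R \top))
  (ccomp (vadd_fun X) (cpair (cid_fun X) (cconst X y)))).
have sE z : s \top z = vscale (t : R \top) (vadd z y).
  by rewrite /s /= /vscale /vadd /cop !cproj_top.
have sc : ccontinuous T T s.
  apply: ccontinuous_comp; first exact: tvs_scale_cont.
  apply: (ccontinuous_pair Ac) => //; first exact: ccontinuous_const.
  apply: ccontinuous_comp; first exact: tvs_add_cont.
  apply: (ccontinuous_pair Ac) => //; first exact: ccontinuous_id.
  exact: ccontinuous_const.
have [Q /(is_cpreimageP Ac) QB TQ] := sc _ TB.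
(* Restriction to [a] keeps the part on which the ball around [f x] lies in [O]. *)
have VE z : tmem z (crestr a Q) = a `&` tmem (vscale (t : R \top) (vadd z y)) B.
  by rewrite tmem_crestr // QB sE.
have -> : a = tmem x (crestr a Q).
  by rewrite VE xy vscaler0; move/(tmemP Ac): B0 => ->; rewrite meetx1.
apply: (le_bsup Ac); exists (crestr a Q) => //; split; first exact: ctop_crestr.
apply/(csubsetP Ac) => z; rewrite VE PO; set b := _ `&` _.
have fzx : b <= tle (rnorm ((f \top z : rtop R) - (f \top x : rtop R))%R) e.
  have fy : f \top y = (- (f \top x : rtop R))%R :> rtop R.
    by apply/esym/GRing.addr0_eq; rewrite -clinearD // xy clinear0.
  have := le_trans (leIr _ _) (fB (vscale (t : R \top) (vadd z y))) : b <= _.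
  rewrite clinearZ // clinearD // fy => tzx.
  have := rnormM_le Ac e tzx; rewrite GRing.mulrA et GRing.mul1r GRing.mulr1.
  by move=> /(tle_trans Ac); apply; exact: rnorm_pos.
apply: le_trans (_ : b <= a `&`
  tle (rnorm ((f \top z : rtop R) - (f \top x : rtop R))%R) e) _.
  by rewrite lexI leIl.
rewrite leI_impl; exact: (bforall_le Ac (fun z =>
  ~` tle (rnorm (z - _)%R) e `|` tmem (z : R \top) O)).
Qed.

End TVS.

(** A local map on level \top determines the other levels: its values there are computed on chosen
    preimages, and locality makes the choice immaterial. *)
Lemma cfun_of (X Y : condSet A) (F : X \top -> Y \top) :
  (forall a x y, cproj a x = cproj a y -> cproj a (F x) = cproj a (F y)) ->
  exists f : cfun X Y, forall x, f \top x = F x.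
Proof.
move=> Floc; pose pre a (y : X a) := projT1 (cid (cproj_surj y)).
have preE a (y : X a) : cproj a (pre a y) = y by rewrite /pre; case: cid.
have preT x : pre \top x = x by rewrite -[LHS]cproj_top preE.
have fE a x : cproj a (F (pre a (cproj a x))) = cproj a (cproj \top (F (pre \top x))).
  by rewrite cproj_top preT; apply: Floc; rewrite preE.
exists (@Cfun d A X Y (fun a y => cproj a (F (pre a y))) fE) => x /=.
by rewrite preT cproj_top.
Qed.

End LinearMaps.

(** * The Banach-Alaoglu theorem *)

Section BanachAlaoglu.
Context d (A : ctbDistrLatticeType d) (Ac : complete A) (R : condReal A).
Context (X : condTVS R) (X' : condVect R) (p : dualPair X X').

Lemma pairingDl x y x' :
  pairing p (vadd x y) x' = ((pairing p x x' : rtop R) + pairing p y x')%R.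
Proof.
by have := clinearD (dp_linl p x') x y; rewrite /= cproj_top.
Qed.

Lemma pairingZl (k : rtop R) x x' :
  pairing p (vscale (k : R \top) x) x' = (k * (pairing p x x' : rtop R))%R.
Proof.
by have := clinearZ (dp_linl p x') k x; rewrite /= cproj_top.
Qed.

Lemma teq_pairing a x y x' : a <= teq x y ->
  a <= teq (pairing p x x') (pairing p y x').
Proof.
move=> /(le_teq Ac) xy; apply/(le_teq Ac).
by rewrite /pairing -!copE xy.
Qed.

(** Some positive [e] puts the multiple of [x] by [e] into [U], so the pairing is bounded by 1/e. *)
Lemma polar_bounded (U : csub X) : is_nbhs (tvs_top X) (vzero : X \top) U ->
  forall x, exists k : rtop R, forall x', csub_elt (cpolar p U) x' ->
    \top <= tle (rnorm (pairing p x x')) k.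
Proof.
move=> [_ [B TB [B0 /(csubsetP Ac) BU]]] x.
have [e e0 exB] := open_absorbing Ac x TB B0.
have exU : cmem (vscale (e : R \top) x) U.
  apply/(tmemP Ac)/eqP; rewrite -le1x; apply: le_trans (BU _).
  by move/(tmemP Ac): exB => ->.
have [t et _] := rpos_inv Ac e0; exists (rnorm t) => x' /(_ _ exU) /(le_tleP Ac).
rewrite pairingZl => /(rnormM_le Ac t).
by rewrite GRing.mulrA [(t * e)%R]GRing.mulrC et GRing.mul1r GRing.mulr1.
Qed.

(* The bound on the polar makes every evaluation x' |-> <x, x'> converge along
   h, and the limit is continuous because it is bounded by 1 on U. *)
Lemma polar_limit (U : csub X) (h : ({x' | csub_elt (cpolar p U) x'} -> A) -> A) :
  compatible X p -> is_nbhs (tvs_top X) (vzero : X \top) U ->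
  Afilter h -> (forall P, h P `|` h (fun i => ~` P i) = \top) ->
  (forall a, h (fun=> a) = a) ->
  exists2 x0, csub_elt (cpolar p U) x0 &
    forall x, lim_along h (fun i => pairing p x (sval i)) (pairing p x x0).
Proof.
move=> X_comp U_nbhs hF hU hC.
pose v x : {x' | csub_elt (cpolar p U) x'} -> rtop R :=
  fun i => pairing p x (sval i).
have /choice[phi phiP] x : exists l, lim_along h (v x) l.
  have [k kP] := polar_bounded U_nbhs x.
  have kv i : \top <= tle (rnorm (v x i)) k by apply: kP; case: i.
  apply: (lim_along_ex Ac hF hC hU (k := k)) => i; last first.
    by apply: (tle_trans Ac _ (kv i)); case: (tle_rabs Ac \top (v x i)).
  apply: (tle_shift Ac (u := (- v x i)%R) (v := k)); first by ring.
  by apply: (tle_trans Ac _ (kv i)); case: (tle_rabs Ac \top (v x i)).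
have [f fE] : exists f : cfun X R, forall x, f \top x = phi x.
  apply: cfun_of => a x y /(le_teq Ac) xy; apply/(le_teq Ac).
  apply: (lim_along_teq Ac hF hC (phiP x) (phiP y)) => i; exact: teq_pairing.
have flin : clinear f.
  move=> l x y; rewrite !fE.
  apply: (lim_along_unique Ac hF hC (phiP _)).
  have := lim_alongD Ac hF (lim_alongM Ac hF l (phiP x)) (phiP y).
  congr (lim_along _ _ _); apply/funext => i.
  by rewrite /v pairingDl pairingZl.
have f1 x : cmem x U -> rle (rabs (f \top x)) rone.
  move=> xU; rewrite fE; apply/(le_tleP Ac); rewrite -[rone]/(1%R : rtop R).
  have v1 i : \top <= tle (rnorm (v x i)) 1%R.
    by apply/(le_tleP Ac); case: i => x' x'P; exact: x'P.
  apply: (rabs_le Ac).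
    apply: (lim_along_mono Ac hF hC (phiP x) (lim_along_cst Ac hF 1%R)).
    apply: filter_all => // i; apply: (tle_trans Ac _ (v1 i)).
    by case: (tle_rabs Ac \top (v x i)).
  apply: (tle_shift Ac (u := (- 1)%R) (v := phi x)); first by ring.
  apply: (lim_along_mono Ac hF hC (lim_along_cst Ac hF (- 1)%R) (phiP x)).
  apply: filter_all => // i.
  apply: (tle_shift Ac (u := (- v x i)%R) (v := 1%R)); first by ring.
  apply: (tle_trans Ac _ (v1 i)).
  by case: (tle_rabs Ac \top (v x i)).
have : range (cpartl (dp_fun p)) f.
  by rewrite -X_comp; split=> //; exact: (bounded_ccontinuous Ac flin U_nbhs f1).
case=> x0 _ x0f; have x0E x : pairing p x x0 = phi x.
  by rewrite -fE -x0f /= cproj_top.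
exists x0 => [|x]; first by move=> x xU; rewrite x0E -fE; exact: f1.
by rewrite x0E; exact: phiP.
Qed.

(** [weak_top] is the smallest topology with continuous evaluations, and [conv_top] is such a
    topology. *)
Lemma weak_top_conv E (h : (E -> A) -> A) (g : E -> X' \top) x0 : Afilter h ->
  (forall x, lim_along h (fun i => pairing p x (g i)) (pairing p x x0)) ->
  weak_top p `<=` conv_top h g x0.
Proof.
move=> hF hlim W; apply; split; first exact: conv_top_ctop.
move=> _ [x _ <-]; apply: (ccontinuous_conv Ac) => O EO /=; rewrite cproj_top.
exact: (lim_along_open Ac hF (hlim x) EO).
Qed.

Lemma polar_compact (U : csub X) : compatible X p ->
  is_nbhs (tvs_top X) (vzero : X \top) U -> ccompact (weak_top p) (cpolar p U).
Proof.
move=> X_comp U_nbhs J O _ Oopen [G /(is_cjoinP Ac) GE /(csubsetP Ac) YG].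
set Y := cpolar p U in Oopen YG *.
pose E := {x' | csub_elt Y x'}.
have memY x' : csub_elt Y x' -> cmem x' Y.
  by move=> Yx'; split; [exact: lexx|exists x' => //; rewrite cres_top cproj_top].
have Ymem x' : cmem x' Y -> csub_elt Y x'.
  by case=> _ [u Yu]; rewrite cres_top cproj_top => <-.
have [y0 Yy0] := csub_neq0 Y.
(* [N D i] is the value with which the members indexed by [D] cover [i]. Unions of index sets make
   [N] directed, and the empty set provides an index. *)
pose N (D : {D : set (J \top) | finite_set D}) (i : E) :=
  bsup [set tmem (sval i) (O j) | j in sval D].
have [D D'|h [hF hU hC hN]] := ultrafilter_ex Ac (exist _ y0 Yy0 : E)
    (exist _ set0 (@finite_set0 _)) (N := N).
  have fin : finite_set (sval D `|` sval D').
    by rewrite finite_setU; split; exact: svalP.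
  exists (exist _ _ fin) => i; rewrite leUx; apply/andP.
  by split; apply: (bsup_le Ac) => _ [j Dj <-]; apply: (le_bsup Ac);
    exists j => //; [left|right].
set g := bexists _ in hN.
have [x0 Yx0 x0lim] := polar_limit X_comp U_nbhs hF hU hC.
(* [O j] is the trace on [Y] of a weakly open [W]. On points of [Y] both have the same truth value,
   so convergence bounds it by the value of [h] at the singleton cover. *)
have Oh j : tmem x0 (O j) <= g.
  have [W TW /(is_cmeetP Ac) OE] := Oopen j; rewrite OE.
  apply: le_trans (leIl _ _) _.
  apply: le_trans (weak_top_conv hF x0lim TW) _.
  have fin : finite_set [set j] by exact: finite_set1.
  apply: le_trans (hN (exist _ _ fin)); apply: filter_le => // i.
  apply: le_trans (_ : tmem (sval i) (O j) <= _).
    rewrite OE; have /memY/(tmemP Ac) -> : csub_elt Y (sval i) by case: i.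
    by rewrite meetx1.
  by apply: (le_bsup Ac); exists j.
have g1 : \top <= g.
  have /memY/(tmemP Ac) <- := Yx0; apply: le_trans (YG x0) _; rewrite GE.
  by apply: (bsup_le Ac) => _ [_ [j _ <-] <-].
(* As [g] is a supremum over finite index sets, exhaustion gives a partition with one such set
   filling the polar on each piece. *)
have [I [c [D [pc cD]]]] := exhaustion Ac g1.
exists I, c, (fun i => sval (D i)); split=> // i; split; first exact: svalP.
have [H HE] := csub_join Ac [set W | exists2 j, sval (D i) j &
  is_cmeet (O j) (crestr (c i) Y) W].
exists H => //; apply/(csubsetP Ac) => x.
move/(is_cjoinP Ac): HE => HE; rewrite HE tmem_crestr //; set b := _ `&` _.
(* The covering is known at global points of the polar, so [x] is replaced by one that agrees with
   it on [b]. *)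
have [y /Ymem Yy yx] := cmem_extend Ac (memY _ Yy0) (leIr _ _ : b <= tmem x Y).
have bN : b <= N (D i) (exist _ y Yy).
  apply: le_trans (leIl _ _) _; apply: le_trans (cD i) _.
  exact: bforall_le.
rewrite -[X in X <= _]meetxx; apply: le_trans (leI2 (lexx b) bN) _.
rewrite meetC leI_impl; apply: (bsup_le Ac) => _ [j Dj <-] /=.
rewrite -leI_impl meetC.
have [W OW] := csub_meet Ac (O j) (crestr (c i) Y).
apply: le_trans (_ : tmem x W <= _); last first.
  by apply: (le_bsup Ac); exists W => //; exists j.
move/(is_cmeetP Ac): OW => ->; rewrite tmem_crestr // -/b lexI leIl andbT.
by apply: (le_tmem_teq Ac (x := y)); [exact: le_trans (leIl _ _) yx|exact: leIr].
Qed.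

End BanachAlaoglu.

Theorem theorem5p14 (d : Order.disp_t) (A : ctbDistrLatticeType d)
    (A_complete : complete A) (A_nontrivial : \bot <> \top :> A)
    (R : condReal A) (X : condTVS R) (X' : condVect R) (p : dualPair X X')
    (X_locally_convex : locally_convex X) (X_compatible : compatible X p)
    (U : csub X) (U_nbhs : is_nbhs (tvs_top X) (vzero : X \top) U) :
  ccompact (weak_top p) (cpolar p U).
Proof. exact: polar_compact. Qed.
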